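(* Let $\varphi_0:L^\infty\to\mathbb{R}$ be a finite-valued monotone convex function with the Lebesgue property on $L^\infty$ and $\varphi_0(0)=0$, and let $\varphi_0^*$, $\hat\varphi$, $M^{\hat\varphi}$, $M^{\hat\varphi}_u$ be as defined in the context. For $X\in M^{\hat\varphi}$, the following three conditions are equivalent: (1) $X\in M^{\hat\varphi}_u$; (2) $\{XZ:\ Z\in L^1,\ \varphi_0^*(Z)\le c\}$ is uniformly integrable for all $c>0$; (3) for some $\varepsilon>0$, the supremum $\sup_{Z\in\mathrm{dom}\,\varphi_0^*}\big(\mathbb{E}[(|X|\vee\varepsilon)YZ]-\varphi_0^*(Z)\big)$ is attained for all $Y\in L^\infty$. Moreover, these three equivalent conditions imply that $$\hat\varphi(X)=\max_{Z\in\mathrm{dom}\,\varphi_0^*}\big(\mathbb{E}[XZ]-\varphi_0^*(Z)\big),$$ i.e. the supremum defining $\hat\varphi(X)$ is attained.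
   Context: $(\Omega,\mathcal{F},\mathbb{P})$ is a probability space; $L^0$ is the space of finite real random variables modulo $\mathbb{P}$-a.s. equality with the a.s. pointwise order; $L^p=L^p(\Omega,\mathcal F,\mathbb P)$; $\mathbb{E}$ is expectation under $\mathbb{P}$; uniform integrability is with respect to $\mathbb{P}$; $X^-=\max(-X,0)$, $a\vee b=\max(a,b)$. A monotone convex function on $L^\infty$ is a proper convex function $\varphi:L^\infty\to(-\infty,\infty]$ with $X\le Y$ a.s. $\Rightarrow\varphi(X)\le\varphi(Y)$. It has the Lebesgue property on $L^\infty$ if $\sup_n\|X_n\|_\infty<\infty$ and $X_n\to X$ a.s. imply $\varphi(X)=\lim_n\varphi(X_n)$. Definitions associated to $\varphi_0$: $\varphi_0^*(Z)=\sup_{X\in L^\infty}(\mathbb{E}[XZ]-\varphi_0(X))$ for $Z\in L^1$, $\mathrm{dom}\,\varphi_0^*=\{Z\in L^1:\varphi_0^*(Z)<\infty\}$ (every element of which is $\ge0$ by monotonicity); $\mathcal{D}_0=\{X\in L^0: X^-Z\in L^1\ \forall Z\in\mathrm{dom}\,\varphi_0^*\}$; $\hat\varphi(X)=\sup_{Z\in\mathrm{dom}\,\varphi_0^*}(\mathbb{E}[XZ]-\varphi_0^*(Z))$ for $X\in\mathcal{D}_0$ (note $L^0_+\subset\mathcal{D}_0$); $$M^{\hat\varphi}=\{X\in L^0:\ \hat\varphi(\alpha|X|)<\infty\ \ \forall\alpha>0\},$$ $$M^{\hat\varphi}_u=\Big\{X\in L^0:\ \lim_{N\to\infty}\hat\varphi\big(\alpha|X|\mathbf{1}_{\{|X|>N\}}\big)=0\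 \ \forall\alpha>0\Big\}.$$ One has $M^{\hat\varphi}_u\subset M^{\hat\varphi}\subset\mathcal{D}_0$, and $XZ\in L^1$ for all $X\in M^{\hat\varphi}$, $Z\in\mathrm{dom}\,\varphi_0^*$. *)

(* Defs.v *)
From HB Require Import structures.
From mathcomp Require Import all_boot all_order all_algebra.
From mathcomp Require Import all_classical all_reals all_analysis.

Set Implicit Arguments.
Unset Strict Implicit.
Unset Printing Implicit Defensive.

Import Order.TTheory GRing.Theory Num.Def Num.Theory.
Import numFieldNormedType.Exports.

Local Open Scope classical_set_scope.
Local Open Scope ring_scope.
Local Open Scope ereal_scope.

(* Elements of L^0, L^1 and L^infty are represented by measurable functions,
   without passing to the quotient by a.s. equality: [monotone] below forces a
   functional on L^infty to be invariant under a.s. equality, and all the other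
   notions only involve expectations and a.s. relations. *)
Notation Linfty P := (LfunType P (leey 1)).
Notation L1 P := (LfunType P (lexx (1 : \bar _))).

Section monotone_convex.
Context {d : measure_display} {T : measurableType d} {R : realType}.
Variable P : probability T R.
Implicit Types phi : Linfty P -> R.

Definition monotone phi := forall X Y : Linfty P,
  (\forall w \ae P, (X w <= Y w)%R) -> (phi X <= phi Y)%R.

Definition monotone_convex phi :=
  monotone phi /\ convex_function (setT : set (convex_lmodType (Linfty P))) phi.

Definition Lebesgue_property phi :=
  forall (X_ : nat -> Linfty P) (X : Linfty P),
    ereal_sup (range (fun n => 'N[P]_+oo[EFin \o X_ n])) < +oo ->
    (\forall w \ae P, X_ n w @[n --> \oo] --> X w) ->
    phi (X_ n) @[n --> \oo] --> phi X.

Definition uniformly_integrable (F : set (T -> R)) :=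
  (forall f, F f -> f \in Lfun P 1) /\
  forall e : R, (0 < e)%R -> exists K : R, forall f, F f ->
    'E_P[fun w => (`|f w| * \1_[set w' | K < `|f w'|] w)%R] <= e%:E.

End monotone_convex.

Section conjugate.
Context {d : measure_display} {T : measurableType d} {R : realType}.
Context {P : probability T R}.
Variable phi : Linfty P -> R.

Definition conj_phi (Z : L1 P) : \bar R :=
  ereal_sup [set 'E_P[X \* Z] - (phi X)%:E | X in [set: Linfty P]].

Definition dom_conj : set (L1 P) := [set Z | conj_phi Z < +oo].

Definition dual_objective (X : T -> R) (Z : L1 P) : \bar R :=
  'E_P[X \* Z] - conj_phi Z.

(* Total in X; meaningful for measurable X with X^- Z integrable for all Z in
   [dom_conj], where 'E_P[X \* Z] is a well-defined element of ]-oo, +oo]. This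
   covers X >= 0, the only case used in [M_hat] and [Mu_hat], and X in
   [M_hat]. *)
Definition hat_phi (X : T -> R) : \bar R :=
  ereal_sup [set dual_objective X Z | Z in dom_conj].

Definition M_hat : set {RV P >-> R} :=
  [set X | forall a : R, (0 < a)%R ->
    hat_phi (fun w => a * `|X w|)%R < +oo].

Definition Mu_hat : set {RV P >-> R} :=
  [set X | forall a : R, (0 < a)%R ->
    hat_phi (fun w => a * `|X w| * \1_[set w' | N%:R < `|X w'|] w)%R
      @[N --> \oo] --> 0].

End conjugate.

Definition sup_attained {U : Type} {R : realType} (A : set U)
    (f : U -> \bar R) :=
  exists2 u, A u & f u = ereal_sup [set f v | v in A].

(* Main.v *)
Require Import Defs.
From HB Require Import structures.
From mathcomp Require Import all_boot all_order all_algebra.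
From mathcomp Require Import all_classical all_reals all_analysis.
From mathcomp Require Import measurable_realfun ess_sup_inf ring lra.

Set Implicit Arguments.
Unset Strict Implicit.
Unset Printing Implicit Defensive.

Import Order.TTheory GRing.Theory Num.Def Num.Theory.
Import numFieldNormedType.Exports.

Local Open Scope classical_set_scope.
Local Open Scope ring_scope.

(** The three conditions are proved equivalent along (1) => (2) => (3) => (1).
    Write phi for phi_0 and phi^* for its conjugate; elements of dom phi^* are
    a.s. nonnegative.

    (1) => (2). If phi^*(Z) <= c, the Fenchel-Young inequality bounds
    a E[|X| 1_(|X| > N) Z] by hat phi(a |X| 1_(|X| > N)) + c, which is at most
    1 + c for N large. Hence the part of XZ where |X| > N is uniformly small,
    and where |X| <= N uniform integrability is inherited from
    {Z : phi^*(Z) <= c}. The latter set is uniformly integrable because of the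
    Lebesgue property ([sublevel_uniformly_integrable]).

    (2) => (3), and the last assertion. As hat phi(a |X|) is finite for every a,
    the objective E[VZ] - phi^*(Z) with |V| <= K (1 + |X|) is at most
    M - phi^*(Z) / 2 ([dominated_objective_le]), so that maximising sequences
    stay in a sublevel set of phi^*, on which (1 + |X|) Z is uniformly
    integrable. Weak compactness is avoided: since the superlevel sets of the
    objective are convex, a maximising sequence can be chosen which almost
    minimises the strictly convex functional E[1 / (1 + (1 + |X|) Z)], and such
    a sequence converges in L^1 ([midpoint_convex_compact]). The objective is
    upper semicontinuous along it, so its limit is a maximiser
    ([objective_attained]).

    (3) => (1). This is a James-type statement. Put W = |X| \/ e and
    Phi(Y) = hat phi(W Y) for Y bounded. A maximiser Z for W Y yields the
    order continuous subgradient W Z of Phi at Y, so by (3) the finite monotone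
    convex function Phi has such a subgradient at every point. Suppose that
    Phi(V_n) stayed above Phi(0) + 2 eta along some V_n decreasing to 0. In the
    spirit of the proof of Simons' inequality, one sums a series
    U = sum_k 2^-k V_(n_k) with indices chosen so large that Phi increases
    by at least 2^-m eta from each partial sum U_m to U, whereas U - U_m is at
    most 2^-m V_m. A subgradient Z at U would satisfy E[V_m Z] >= eta for all m,
    against dominated convergence ([order_continuous_subgradients_cvg]). With
    V_n = a 1_(|X| > n) the conclusion says that hat phi(a |X| 1_(|X| > n))
    becomes arbitrarily small.

    It remains to bound hat phi(a |X| 1_(|X| > n)) below by 0, for which it
    suffices to find Z with phi^*(Z) = 0 ([exists_dual_zero]). A linear form
    below phi exists by a Hahn-Banach argument ([exists_linear_minorant]); it is
    positive by monotonicity and order continuous by the Lebesgue property, so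
    that the Radon-Nikodym theorem gives it a density. *)

(** * Linear minorants of convex functions *)

Section linear_minorant.
Context {R : realType} {E : lmodType R}.
Implicit Types (p : E -> R) (u v x y : E).

(** Same notion as [convex_function] on the whole space, with a real parameter
    so that instances are plain linear inequalities. *)
Definition convex_fun (f : E -> R) := forall x y (t : R), 0 <= t <= 1 ->
  f (t *: x + (1 - t) *: y) <= t * f x + (1 - t) * f y.

Let convex_minorant p (f : E -> R) := [/\ convex_fun f, f 0 = 0 & forall x, f x <= p x].

Let inf_ler (A : set R) (m r : R) : lbound A m -> A r -> inf A <= r.
Proof. by move=> Am Ar; apply: ge_inf => //; exists m. Qed.

Let convex_fun_half f x y : convex_fun f -> f (2^-1 *: (x + y)) <= (f x + f y) / 2.
Proof.
move=> fc; have := fc x y 2^-1; rewrite scalerDr.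
have -> : (1 - 2^-1 : R) = 2^-1 by lra.
by move=> /(_ _)/le_trans; apply; [lra|rewrite -mulrDr mulrC].
Qed.

Let minorant_geN p f x : convex_minorant p f -> - p (- x) <= f x.
Proof.
move=> [fc f0 fp]; have := convex_fun_half x (- x) fc.
rewrite subrr scaler0 f0 => h; have := fp (- x); lra.
Qed.

(* The last hypothesis holds for directed families of convex functions, as in
   chains, and for jointly convex functions, as in partial infima. *)
Let convex_fun_inf (I : Type) (D : set I) (F : E -> I -> R) (m : E -> R) :
  D !=set0 -> (forall x i, D i -> m x <= F x i) ->
  (forall x y (t : R) i j, 0 <= t <= 1 -> D i -> D j -> exists2 k, D k &
     F (t *: x + (1 - t) *: y) k <= t * F x i + (1 - t) * F y j) ->
  convex_fun (fun x => inf [set F x i | i in D]).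
Proof.
move=> [i0 Di0] Fm Fc x y t t01.
have lbF z : has_lbound [set F z i | i in D].
  by exists (m z) => _ [i Di <-]; exact: Fm.
have infF z : has_inf [set F z i | i in D] by split=> //; exists (F z i0), i0.
apply/ler_addgt0Pr => e e0.
have [_ [i Di <-] Fi] := inf_adherent e0 (infF x).
have [_ [j Dj <-] Fj] := inf_adherent e0 (infF y).
have [k Dk Fk] := Fc x y t i j t01 Di Dj.
apply: (@le_trans _ _ (F (t *: x + (1 - t) *: y) k)).
  by apply: ge_inf => //; exists k.
apply: (le_trans Fk).
case/andP: t01 => t0 t1.
have := ler_wpM2l t0 (ltW Fi); have t1' : 0 <= 1 - t by lra.
have := ler_wpM2l t1' (ltW Fj); rewrite !mulrDr !mulrDl !mul1r; nra.
Qed.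

Let minorant_chain p (A : set {f | convex_minorant p f}) : A !=set0 ->
  (forall f g : {f | convex_minorant p f}, A f -> A g ->
    (forall x, sval g x <= sval f x) \/ (forall x, sval f x <= sval g x)) ->
  exists g : {f | convex_minorant p f}, forall f, A f ->
    forall x, sval g x <= sval f x.
Proof.
move=> A0 Atot; pose g x := inf [set sval f x | f in A].
have lb x f : A f -> - p (- x) <= sval f x by move=> Af; exact: minorant_geN (svalP f).
have gle f x : A f -> g x <= sval f x.
  by move=> Af; apply: (@inf_ler _ (- p (- x))); [move=> _ [h Ah <-]; exact: lb|exists f].
suff gP : convex_minorant p g by exists (exist _ g gP) => f Af x /=; exact: gle.
split.
- apply: (convex_fun_inf (m := fun x => - p (- x))) => // x y t i j t01 Ai Aj.
  have [t0 t1] := andP t01; have t1' : 0 <= 1 - t by lra.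
  have [ji|ij] := Atot i j Ai Aj.
  + exists j => //; have [jc _ _] := svalP j.
    by apply: (le_trans (jc _ _ _ t01)); rewrite lerD2r ler_wpM2l.
  + exists i => //; have [ic _ _] := svalP i.
    by apply: (le_trans (ic _ _ _ t01)); rewrite lerD2l ler_wpM2l.
- rewrite /g (_ : image _ _ = [set 0]) ?inf1//.
  apply/seteqP; split => [_ [f Af <-]|_ ->]; first by have [] := svalP f.
  by have [f Af] := A0; exists f => //; have [] := svalP f.
- move=> x; have [f Af] := A0; apply: (le_trans (gle f x Af)).
  by have [] := svalP f.
Qed.

Let minimal_minorant p : convex_fun p -> p 0 = 0 ->
  exists2 f, convex_minorant p f &
    forall g, convex_minorant p g -> (forall x, g x <= f x) -> forall x, f x <= g x.
Proof.
move=> pc p0.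
have pP : convex_minorant p p by [].
pose rle (f g : {f | convex_minorant p f}) := `[< forall x, sval g x <= sval f x >].
have [||A Atot|f fmin] := @ZL_preorder _ (exist _ p pP) rle.
- by move=> f; apply/asboolP.
- move=> f g h /asboolP fg /asboolP gh; apply/asboolP => x.
  exact: le_trans (gh x) (fg x).
- have [A0|/set0P/negP/negPn/eqP->] := pselect (A !=set0); last first.
    by exists (exist _ p pP).
  have [//||g gP] := @minorant_chain p A.
    by move=> f g Af Ag; case: (Atot f g Af Ag) => /asboolP; [left|right].
  by exists g => f /gP ?; exact/asboolP.
exists (sval f) => [|g gP gf]; first exact: (svalP f).
by have /asboolP := fmin (exist _ g gP) (asboolT gf); exact.
Qed.

(* The right derivative of [f] at [0] in the direction [v] supports [f] along the
   whole line spanned by [v]. *)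
Let supporting_slope p f v : convex_minorant p f ->
  exists c : R, forall s : R, s * c <= f (s *: v).
Proof.
move=> [fc f0 _].
pose S := [set f (s *: v) / s | s in [set s : R | 0 < s]].
have lbS (r : R) : 0 < r -> lbound S (- (f (- r *: v) / r)).
  move=> r0 _ [s /= s0 <-].
  have rs : 0 < r + s by rewrite addr_gt0.
  have rsn0 : r + s != 0 by rewrite gt_eqF.
  have h := fc (s *: v) (- r *: v) (r / (r + s)).
  have : 0 <= r / (r + s) * f (s *: v) + (1 - r / (r + s)) * f (- r *: v).
    have c0 : (r / (r + s)) *: (s *: v) + (1 - r / (r + s)) *: (- r *: v) = 0.
      rewrite !scalerA -scalerDl.
      have -> : r / (r + s) * s + (1 - r / (r + s)) * - r = 0 by field.
      by rewrite scale0r.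
    rewrite -f0 -c0; apply: h; apply/andP; split; first by rewrite divr_ge0// ltW.
    by rewrite ler_pdivrMr// mul1r lerDl ltW.
  have -> : 1 - r / (r + s) = s / (r + s) by field.
  move=> /(ler_wpM2l (ltW rs)); rewrite mulr0 mulrDr !mulrA.
  rewrite ![(r + s) * _ / _]mulrAC divff// !mul1r => h'.
  rewrite -subr_ge0 opprK.
  have -> : f (s *: v) / s + f (- r *: v) / r =
      (r * f (s *: v) + s * f (- r *: v)) / (s * r).
    by field; rewrite !gt_eqF.
  by rewrite divr_ge0// mulr_ge0// ltW.
have S0 : S !=set0 by exists (f (1 *: v) / 1), 1 => //=.
exists (inf S) => s; have [s0|s0|->] := ltgtP s 0.
- have r0 : 0 < - s by lra.
  have h : - (f (s *: v) / - s) <= inf S.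
    by apply: lb_le_inf => //; have := lbS _ r0; rewrite opprK.
  move: h; rewrite invrN mulrN opprK => /(ler_wnM2l (ltW s0)).
  by rewrite mulrCA divff ?mulr1// lt_eqF.
- have h : inf S <= f (s *: v) / s.
    by apply: inf_ler (lbS _ ltr01) _; exists s.
  by move: h; rewrite ler_pdivlMr// mulrC.
- by rewrite mul0r scale0r f0.
Qed.

(** A convex function vanishing at the origin dominates a linear form: a minimal
    convex minorant [f] vanishing at the origin is linear, because for a slope
    [c] of [f] in a direction [v], the function inf_s (f (x + s v) - s c) is
    another one, so that it cannot lie strictly below [f]. *)
Lemma exists_linear_minorant p : convex_fun p -> p 0 = 0 ->
  exists2 l : E -> R, (forall (k : R) u v, l (k *: u + v) = k * l u + l v) &
    forall x, l x <= p x.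
Proof.
move=> pc p0; have [f fP fmin] := minimal_minorant pc p0.
have [fc f0 fp] := fP; exists f => //.
have shift v : exists c : R, forall x s, f x + s * c <= f (x + s *: v).
  have [c cP] := supporting_slope v fP; exists c => x s.
  pose g y := inf [set f (y + r *: v) - r * c | r in setT].
  have lb y r : - f (- y) <= f (y + r *: v) - r * c.
    have := convex_fun_half (y + r *: v) (- y) fc.
    rewrite (addrC y) addrK scalerA => h.
    by have := cP (2^-1 * r); lra.
  have gle y r : g y <= f (y + r *: v) - r * c.
    by apply: (@inf_ler _ (- f (- y))); [move=> _ [h _ <-]; exact: lb|exists r].
  have gf y : g y <= f y by have := gle y 0; rewrite scale0r addr0 mul0r subr0.
  suff gP : convex_minorant p g.
    by have := fmin g gP gf x; have := gle x s; lra.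
  split.
  - apply: (convex_fun_inf (m := fun y => - f (- y))); [by exists 0|by []|].
    move=> y z t i j t01 _ _; exists (t * i + (1 - t) * j) => //.
    have := fc (y + i *: v) (z + j *: v) t t01.
    rewrite (_ : t *: (y + i *: v) + (1 - t) *: (z + j *: v) =
      t *: y + (1 - t) *: z + (t * i + (1 - t) * j) *: v); first by lra.
    by rewrite !scalerDr !scalerA [(_ + _) *: v]scalerDl addrACA.
  - apply/eqP; rewrite eq_le (le_trans (gf 0)) ?f0//=; apply: lb_le_inf.
      by exists (f (0 + (0 : R) *: v) - 0 * c); exists 0.
    by move=> _ [r _ <-]; rewrite add0r subr_ge0.
  - by move=> y; exact: le_trans (gf y) (fp y).
have eqshift v : exists c : R, forall x s, f (x + s *: v) = f x + s * c.
  have [c cP] := shift v; exists c => x s; apply/eqP; rewrite eq_le cP andbT.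
  by have := cP (x + s *: v) (- s); rewrite scaleNr addrK; lra.
move=> k u v; have [c cP] := eqshift u.
have := cP 0 1; rewrite scale1r add0r f0 add0r mul1r => ->.
by rewrite addrC cP addrC.
Qed.

End linear_minorant.

(** * Real-valued expectations *)

Section expectation_tools.
Context {d : measure_display} {T : measurableType d} {R : realType}.
Variable P : probability T R.
Implicit Types f g h : T -> R.

Local Notation integrable f := (P.-integrable [set: T] (EFin \o f)).
Local Notation "\E f" := (Rintegral P setT f) (at level 10, f at level 8).

Lemma integrable_measurable f : integrable f -> measurable_fun [set: T] f.
Proof. by move=> /measurable_int /measurable_EFinP. Qed.

Lemma integrable_cst_fun (k : R) : integrable (fun _ => k).
Proof. exact: finite_measure_integrable_cst. Qed.

Lemma integrableDr f g : integrable f -> integrable g ->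
  integrable (fun w => f w + g w).
Proof.
move=> fi gi; rewrite (_ : _ \o _ = (EFin \o f) \+ (EFin \o g))%E//.
exact: integrableD.
Qed.

Lemma integrableZr_fun (k : R) f : integrable f -> integrable (fun w => k * f w).
Proof.
move=> fi; rewrite (_ : _ \o _ = (fun w => k%:E * (EFin \o f) w))%E//.
exact: integrableZl.
Qed.

Lemma integrableNr f : integrable f -> integrable (fun w => - f w).
Proof.
by move=> fi; under eq_fun do rewrite -mulN1r; exact: integrableZr_fun.
Qed.

Lemma integrableBr f g : integrable f -> integrable g ->
  integrable (fun w => f w - g w).
Proof. by move=> fi gi; apply: integrableDr => //; exact: integrableNr. Qed.

Lemma integrable_normr f : integrable f -> integrable (fun w => `|f w|).
Proof. by move=> fi; exact: integrable_norm. Qed.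

Lemma ae_le_integrable f g : measurable_fun [set: T] f -> integrable g ->
  (\forall w \ae P, `|f w| <= g w) -> integrable f.
Proof.
move=> mf gi fg; apply/integrableP; split; first exact/measurable_EFinP.
have mg := integrable_measurable gi.
apply: (@le_lt_trans _ _ (\int[P]_w (`|g w|)%:E)%E).
  apply: ae_ge0_le_integral => //.
  - by apply: measurableT_comp => //; exact/measurable_EFinP.
  - by apply/measurable_EFinP; exact: measurableT_comp.
  - by apply: filterS fg => w h _; rewrite /= lee_fin (le_trans h) ?ler_norm.
by move: gi => /integrableP[].
Qed.

Lemma bounded_integrable f (k : R) : measurable_fun [set: T] f ->
  (\forall w \ae P, `|f w| <= k) -> integrable f.
Proof. by move=> mf fk; apply: ae_le_integrable mf (integrable_cst_fun k) fk. Qed.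

Lemma integrable_expect f : integrable f -> ('E_P[f] = (\E f)%:E)%E.
Proof.
move=> fi; rewrite unlock /Rintegral fineK//; exact: integrable_fin_num.
Qed.

Lemma expectD f g : integrable f -> integrable g ->
  \E (fun w => f w + g w) = \E f + \E g.
Proof. by move=> fi gi; rewrite RintegralD. Qed.

Lemma expectB f g : integrable f -> integrable g ->
  \E (fun w => f w - g w) = \E f - \E g.
Proof. by move=> fi gi; rewrite RintegralB. Qed.

Lemma expectZ (k : R) f : integrable f -> \E (fun w => k * f w) = k * \E f.
Proof. by move=> fi; rewrite RintegralZl. Qed.

Lemma expect_cst (k : R) : \E (fun _ => k) = k.
Proof. by rewrite Rintegral_cst//= probability_setT mulr1. Qed.

Lemma ae_eq_expect f g : measurable_fun [set: T] f -> measurable_fun [set: T] g ->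
  (\forall w \ae P, f w = g w) -> \E f = \E g.
Proof.
move=> mf mg fg; congr fine; apply: ae_eq_integral => //.
- exact/measurable_EFinP.
- exact/measurable_EFinP.
- by apply: filterS fg => w fgw _; rewrite fgw.
Qed.

Lemma ae_le_expect f g : integrable f -> integrable g ->
  (\forall w \ae P, f w <= g w) -> \E f <= \E g.
Proof.
move=> fi gi fg; rewrite -subr_ge0 -expectB//.
rewrite (_ : \E _ = \E (fun w => `|g w - f w|)); first exact: Rintegral_ge0.
have mgf := integrable_measurable (integrableBr gi fi).
apply: ae_eq_expect => //; first exact: measurableT_comp.
by apply: filterS fg => w h; rewrite ger0_norm// subr_ge0.
Qed.

Lemma le_expect f g : integrable f -> integrable g ->
  (forall w, f w <= g w) -> \E f <= \E g.
Proof. by move=> fi gi fg; apply: ae_le_expect => //; exact: nearW. Qed.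

Lemma le_norm_expect f : integrable f -> `|\E f| <= \E (fun w => `|f w|).
Proof. by move=> fi; exact: le_normr_Rintegral. Qed.

Lemma expect_dominated_cvg (f_ : nat -> T -> R) f g :
  (forall n, measurable_fun [set: T] (f_ n)) -> measurable_fun [set: T] f ->
  (\forall w \ae P, f_ n w @[n --> \oo] --> f w) -> integrable g ->
  (\forall w \ae P, forall n, `|f_ n w| <= g w) ->
  [/\ integrable f, \E (fun w => `|f_ n w - f w|) @[n --> \oo] --> (0 : R) &
      \E (f_ n) @[n --> \oo] --> \E f].
Proof.
move=> mf_ mf f_f gi f_g.
have f_i n : integrable (f_ n).
  by apply: ae_le_integrable gi _ => //; apply: filterS f_g => w; exact.
have [//| | | | |fi f0 ff] := @dominated_convergence _ T R P setT measurableT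
    (fun n => EFin \o f_ n) (EFin \o f) (EFin \o g).
- by move=> n; exact/measurable_EFinP.
- exact/measurable_EFinP.
- by apply: filterS f_f => w h _; apply: cvg_EFin h; exact: nearW.
- exact: gi.
- by apply: filterS f_g => w h n _; rewrite /= lee_fin.
split => //.
- exact: fine_cvg f0.
- apply: fine_cvg; rewrite fineK//; exact: integrable_fin_num.
Qed.

End expectation_tools.

(** * Completeness of L^1 *)

Section L1_limits.
Context {d : measure_display} {T : measurableType d} {R : realType}.
Variable P : probability T R.
Implicit Types f g h : T -> R.

Local Notation integrable f := (P.-integrable [set: T] (EFin \o f)).
Local Notation "\E f" := (Rintegral P setT f) (at level 10, f at level 8).

Lemma sum_halves_le2 n : \sum_(0 <= k < n) (2^-1 : R) ^+ k <= 2.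
Proof.
suff -> : \sum_(0 <= k < n) (2^-1 : R) ^+ k = 2 - 2 * 2^-1 ^+ n.
  by rewrite lerBlDr lerDl mulr_ge0// exprn_ge0.
elim: n => [|n IH]; first by rewrite big_nil expr0 mulr1 subrr.
by rewrite big_nat_recr//= IH exprS; lra.
Qed.

Lemma halves_lt (e : R) : 0 < e -> exists n, (2^-1 : R) ^+ n < e.
Proof.
move=> e0.
have h : `|2^-1 : R| < 1 by rewrite ger0_norm// invf_lt1// ltr1n.
have /cvgrPdist_lt/(_ e e0)[n _ /(_ n)/= nP] := @cvg_geometric R 1 2^-1 h.
exists n; have := nP (leqnn n); rewrite sub0r normrN mul1r.
by rewrite ger0_norm// exprn_ge0.
Qed.

(** The sum of the increments is integrable, hence a.s. finite, and together with
    the first term it dominates the sequence, which therefore converges a.s. and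
    in L^1. *)
Lemma summable_increments_cvg (u : nat -> T -> R) :
  (forall n, integrable (u n)) ->
  (forall n, \E (fun w => `|u n.+1 w - u n w|) <= (2^-1 : R) ^+ n) ->
  exists2 f, integrable f & \E (fun w => `|u n w - f w|) @[n --> \oo] --> (0 : R).
Proof.
move=> ui ud.
have mu n : measurable_fun [set: T] (u n) by exact: integrable_measurable (ui n).
pose v n w : R := `|u n.+1 w - u n w|.
have vi n : integrable (v n) by apply: integrable_normr; exact: integrableBr.
have mv n : measurable_fun [set: T] (EFin \o v n) by exact: measurable_int (vi n).
have v0 n w : (0 <= (EFin \o v n) w)%E by rewrite /= lee_fin normr_ge0.
pose S w := (\sum_(n <oo) (EFin \o v n) w)%E.
have S0 w : (0 <= S w)%E by apply: nneseries_ge0 => n _ _; exact: v0.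
have mS : measurable_fun [set: T] S.
  by apply: ge0_emeasurable_sum => // n w _ _; exact: v0.
have intS : (\int[P]_w S w <= 2%:E)%E.
  rewrite integral_nneseries//; apply: lime_le.
    by apply: is_cvg_nneseries => n _ _; exact: integral_ge0.
  apply: nearW => n; rewrite (eq_bigr (fun k => (\E (v k))%:E)); last first.
    by move=> k _; rewrite fineK//; exact: integrable_fin_num (vi k).
  rewrite sumEFin lee_fin; apply: le_trans (sum_halves_le2 n).
  by apply: ler_sum => k _; exact: ud.
have Si : P.-integrable [set: T] S.
  apply/integrableP; split => //.
  under eq_integral do rewrite gee0_abs//.
  by rewrite (le_lt_trans intS)// ltry.
have fSi : integrable (fine \o S).
  apply/integrableP; split.
    by apply/measurable_EFinP; exact: measurableT_comp.
  apply: (@le_lt_trans _ _ (\int[P]_w S w)%E); last by rewrite (le_lt_trans intS)// ltry.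
  apply: ge0_le_integral => //.
    by apply: measurableT_comp => //; apply/measurable_EFinP; exact: measurableT_comp.
  by move=> w _ /=; case: (S w) (S0 w) => [r|//|//] /=;
    rewrite ?lee_fin ?normr0 ?leey// => r0; rewrite ger0_norm.
have Sfin : \forall w \ae P, S w \is a fin_num.
  by apply: filterS (integrable_ae measurableT Si) => w; exact.
have partial w n : S w \is a fin_num -> \sum_(0 <= k < n) v k w <= fine (S w).
  move=> Sw; rewrite -lee_fin fineK// -sumEFin.
  by apply: nneseries_lim_ge => k _ _; exact: v0.
have tel n w : u n w = u 0%N w + \sum_(0 <= k < n) (u k.+1 w - u k w).
  by rewrite (telescope_sumr (fun k => u k w))// addrC subrK.
have ucvg w : S w \is a fin_num -> cvgn (fun n => u n w).
  move=> Sw; under eq_fun do rewrite tel.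
  apply: is_cvgD; first exact: is_cvg_cst.
  apply: (@normed_cvg _ _ (fun k => u k.+1 w - u k w)).
  apply: nondecreasing_is_cvgn.
    by apply: nondecreasing_series => n _ _; exact: normr_ge0.
  by exists (fine (S w)) => _ [n _ <-]; exact: partial.
(* The upper limit is a measurable function defined everywhere, also on the null
   set on which the sequence diverges. *)
pose f w := fine (limn_esup (fun n => (u n w)%:E)).
have mf : measurable_fun [set: T] f.
  apply: measurableT_comp => //; apply: measurable_fun_limn_esup => n.
  exact/measurable_EFinP.
have uf w : S w \is a fin_num -> u n w @[n --> \oo] --> f w.
  move=> /ucvg/cvg_ex[l ul]; suff -> : f w = l by [].
  have uE : (u n w)%:E @[n --> \oo] --> l%:E by apply: cvg_EFin ul; exact: nearW.
  by rewrite /f is_cvg_limn_esupE; [rewrite (cvg_lim _ uE)|exact: cvgP uE].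
have gi : integrable (fun w => `|u 0%N w| + fine (S w)).
  by apply: integrableDr fSi; exact: integrable_normr.
have uf_ae : \forall w \ae P, u n w @[n --> \oo] --> f w.
  by apply: filterS Sfin => w; exact: uf.
have u_le : \forall w \ae P, forall n, `|u n w| <= `|u 0%N w| + fine (S w).
  apply: filterS Sfin => w Sw n; rewrite tel (le_trans (ler_normD _ _))// lerD2l.
  by rewrite (le_trans (ler_norm_sum _ _ _))//; exact: partial.
by have [fi f0 _] := expect_dominated_cvg mu mf uf_ae gi u_le; exists f.
Qed.

(** A Cauchy sequence has a subsequence with summable increments. *)
Lemma L1_complete (f_ : nat -> T -> R) : (forall n, integrable (f_ n)) ->
  (forall e : R, 0 < e -> exists N, forall n m, (N <= n)%N -> (N <= m)%N ->
     \E (fun w => `|f_ n w - f_ m w|) <= e) ->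
  exists2 f, integrable f & \E (fun w => `|f_ n w - f w|) @[n --> \oo] --> (0 : R).
Proof.
move=> fi fC.
have h0 k : 0 < (2^-1 : R) ^+ k by rewrite exprn_gt0.
have /choice[N NP] k := fC _ (h0 k).
pose s k := (\sum_(j < k.+1) N j)%N.
have sS k : (s k <= s k.+1)%N by rewrite /s [leqRHS]big_ord_recr leq_addr.
have Ns k : (N k <= s k)%N by rewrite /s big_ord_recr leq_addl.
have [||f f_i uf] := @summable_increments_cvg (f_ \o s).
- by move=> n; exact: fi.
- by move=> n; apply: NP; rewrite ?(leq_trans (Ns n))// sS.
exists f => //; apply/cvgr0Pnorm_lt => e e0.
have e2 : 0 < e / 2 by rewrite divr_gt0.
have [k ke] := halves_lt e2.
move/cvgr0Pnorm_lt : uf => /(_ _ e2)[k' _ k'P].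
pose K := maxn k k'.
exists (s K) => // n /= Kn.
have intn g h : integrable g -> integrable h -> integrable (fun w => `|g w - h w|).
  by move=> gi hi; apply: integrable_normr; exact: integrableBr.
rewrite ger0_norm; last by apply: Rintegral_ge0.
have := k'P K (leq_maxr _ _); rewrite /= ger0_norm => [h|]; last by apply: Rintegral_ge0.
have h' : \E (fun w => `|f_ n w - f_ (s K) w|) <= (2^-1 : R) ^+ K.
  by apply: NP; [exact: leq_trans Kn|exact: Ns].
have hK : (2^-1 : R) ^+ K <= (2^-1 : R) ^+ k.
  by rewrite ler_wiXn2l ?leq_maxl// invf_le1// ler1n.
apply: (@le_lt_trans _ _ (\E (fun w => `|f_ n w - f_ (s K) w| + `|f_ (s K) w - f w|))).
  apply: le_expect; [exact: intn|by apply: integrableDr; exact: intn|].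
  by move=> w; exact: ler_distD.
rewrite expectD; [|exact: intn|exact: intn].
by move: h; rewrite /comp => h; lra.
Qed.

End L1_limits.

(** * Uniform integrability and compactness of convex sets in L^1 *)

Section uniform_integrability.
Context {d : measure_display} {T : measurableType d} {R : realType}.
Variable P : probability T R.
Implicit Types (f g h : T -> R) (K : R).

Local Notation integrable f := (P.-integrable [set: T] (EFin \o f)).
Local Notation "\E f" := (Rintegral P setT f) (at level 10, f at level 8).

Definition tail (K : R) f w : R := if K < `|f w| then `|f w| else 0.

Lemma tail_ge0 K f w : 0 <= tail K f w.
Proof. by rewrite /tail; case: ifP. Qed.

Lemma tail_le_norm K f w : tail K f w <= `|f w|.
Proof. by rewrite /tail; case: ifP. Qed.

Lemma tail_indicE K f :
  tail K f = fun w => `|f w| * \1_[set w' | K < `|f w'|] w.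
Proof.
apply/funext => w; rewrite indicE /tail; case: ifPn => h.
  by rewrite mem_set// mulr1.
by rewrite memNset ?mulr0//; exact/negP.
Qed.

Lemma measurable_norm_gt K f : measurable_fun [set: T] f ->
  measurable [set w | K < `|f w|].
Proof.
move=> mf; rewrite -[X in measurable X]setTI.
have mK : measurable_fun [set: T] (fun w => K < `|f w|).
  by apply: measurable_fun_ltr => //; exact: measurableT_comp.
exact: (mK measurableT [set true]).
Qed.

Lemma tail_integrable K f : integrable f -> integrable (tail K f).
Proof.
move=> fi; have mf := integrable_measurable fi.
apply: ae_le_integrable (integrable_normr fi) _.
  rewrite tail_indicE; apply: measurable_funM; first exact: measurableT_comp.
  by apply: measurable_indic; exact: measurable_norm_gt.
by apply: nearW => w; rewrite ger0_norm ?tail_ge0// tail_le_norm.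
Qed.

Lemma uniformly_integrableP F : uniformly_integrable P F <->
  (forall f, F f -> integrable f) /\
  forall e : R, 0 < e -> exists K, forall f, F f -> \E (tail K f) <= e.
Proof.
split=> [[Fi FK]|[Fi FK]].
  have Fi' f : F f -> integrable f by move=> /Fi /Lfun1_integrable.
  split=> // e /FK[K KP]; exists K => f Ff; have := KP f Ff.
  by rewrite -tail_indicE integrable_expect ?lee_fin//; exact: tail_integrable (Fi' _ Ff).
split=> [f Ff|e /FK[K KP]]; first by apply/Lfun1_integrable; exact: Fi.
exists K => f Ff; rewrite -tail_indicE integrable_expect ?lee_fin ?KP//.
by apply: tail_integrable; exact: Fi.
Qed.

Lemma tail_le K K' f w : K <= K' -> tail K' f w <= tail K f w.
Proof.
move=> KK'; rewrite /tail; case: ifPn => [K'f|_]; last exact: tail_ge0.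
by rewrite (le_lt_trans KK' K'f).
Qed.

(** The larger of [`|g w|] and [`|h w|] is at least half of [`|f w|]; hence the
    factors 2. *)
Lemma tail_le_sum K f g h w : `|f w| <= `|g w| + `|h w| ->
  tail (2 * K) f w <= 2 * (tail K g w + tail K h w).
Proof.
move=> fgh; have g0 := normr_ge0 (g w); have h0 := normr_ge0 (h w).
rewrite /tail; case: (ltP (2 * K) `|f w|) => ?; case: (ltP K `|g w|) => ?;
  case: (ltP K `|h w|) => ?; lra.
Qed.

Lemma uniformly_integrable_le_sum F G H :
  uniformly_integrable P G -> uniformly_integrable P H ->
  (forall f, F f -> measurable_fun [set: T] f /\
     exists g h, [/\ G g, H h & forall w, `|f w| <= `|g w| + `|h w|]) ->
  uniformly_integrable P F.
Proof.
move=> /uniformly_integrableP[Gi GK] /uniformly_integrableP[Hi HK] FGH.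
have Fi f : F f -> integrable f.
  move=> /FGH[mf [g [h [/Gi gi /Hi hi fgh]]]].
  apply: (ae_le_integrable (g := fun w => `|g w| + `|h w|) mf); last exact: nearW.
  by apply: integrableDr; exact: integrable_normr.
apply/uniformly_integrableP; split => // e e0.
have e4 : 0 < e / 4 by rewrite divr_gt0.
have [K1 K1P] := GK _ e4; have [K2 K2P] := HK _ e4.
pose K := Num.max K1 K2; exists (2 * K) => f Ff.
have [_ [g [h [Gg Hh fgh]]]] := FGH _ Ff.
have gi := Gi _ Gg; have hi := Hi _ Hh.
have ti k q : integrable q -> integrable (tail k q) by exact: tail_integrable.
have sumi : integrable (fun w => tail K g w + tail K h w).
  by apply: integrableDr; apply: ti.
apply: (@le_trans _ _ (\E (fun w => 2 * (tail K g w + tail K h w)))).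
  apply: le_expect; [exact: ti (Fi _ Ff)|exact: integrableZr_fun|].
  by move=> w; exact: tail_le_sum.
rewrite expectZ// expectD; [|exact: ti|exact: ti].
have : \E (tail K g) <= \E (tail K1 g).
  by apply: le_expect => [||w]; [exact: ti|exact: ti|rewrite tail_le// le_max lexx].
have : \E (tail K h) <= \E (tail K2 h).
  by apply: le_expect => [||w]; [exact: ti|exact: ti|rewrite tail_le// le_max lexx orbT].
have := K1P _ Gg; have := K2P _ Hh; lra.
Qed.

(* With a = 1/(1+x) and b = 1/(1+y), the gap between the arithmetic mean of a and
   b and their harmonic mean is at least (a - b)^2 / 4. It controls x - y where
   both are at most K, as x - y = (1 + x)(1 + y)(b - a), and |a - b| is bounded
   by r + (a - b)^2 / r. *)
Let inv1_gap (x y K r : R) : 0 <= x -> 0 <= y -> 0 <= K -> 0 < r ->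
  `|x - y| <= (if K < x then x else 0) + (if K < y then y else 0) +
   (1 + K) ^+ 2 * (r + 4 / r * (((1 + x)^-1 + (1 + y)^-1) / 2 - (1 + (x + y) / 2)^-1)).
Proof.
move=> x0 y0 K0 r0.
set a := (1 + x)^-1; set b := (1 + y)^-1; set c := (1 + (x + y) / 2)^-1.
have x1 : 0 < 1 + x by lra. have y1 : 0 < 1 + y by lra.
have gap : (a - b) ^+ 2 / 4 <= (a + b) / 2 - c.
  have a0 : 0 < a by rewrite invr_gt0. have b0 : 0 < b by rewrite invr_gt0.
  have a1 : a <= 1 by rewrite invf_le1//; lra.
  have b1 : b <= 1 by rewrite invf_le1//; lra.
  have -> : c = 2 * a * b / (a + b).
    by rewrite /c /a /b; field; rewrite !gt_eqF//; lra.
  have ab : 0 < a + b by lra.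
  have -> : (a + b) / 2 - 2 * a * b / (a + b) = (a - b) ^+ 2 / (2 * (a + b)).
    by field; rewrite gt_eqF.
  apply: ler_wpM2l; first exact: sqr_ge0.
  by rewrite lef_pV2 ?posrE; lra.
have abr : `|a - b| <= r + 4 / r * ((a + b) / 2 - c).
  have : 0 <= 4 / r by rewrite divr_ge0// ltW.
  move=> /ler_wpM2l/(_ _ _ gap) h.
  suff : `|a - b| <= r + 4 / r * ((a - b) ^+ 2 / 4) by lra.
  have -> : r + 4 / r * ((a - b) ^+ 2 / 4) = (r ^+ 2 + `|a - b| ^+ 2) / r.
    by rewrite real_normK ?num_real//; field; rewrite gt_eqF.
  rewrite ler_pdivlMr//; have := sqr_ge0 (r - `|a - b|); have := normr_ge0 (a - b).
  nra.
have K2 : 0 <= (1 + K) ^+ 2 by exact: sqr_ge0.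
have rhs : (1 + K) ^+ 2 * `|a - b| <= (1 + K) ^+ 2 * (r + 4 / r * ((a + b) / 2 - c)).
  exact: ler_wpM2l.
have rhs0 : 0 <= (1 + K) ^+ 2 * `|a - b| by rewrite mulr_ge0.
have xyab : `|x - y| = (1 + x) * (1 + y) * `|a - b|.
  rewrite -[in RHS](@gtr0_norm _ ((1 + x) * (1 + y))) ?mulr_gt0// -normrM distrC.
  by congr `|_|; rewrite /a /b; field; rewrite !gt_eqF.
apply: le_trans (lerD (lexx _) rhs).
have xyE : (x <= y /\ `|x - y| = y - x) \/ (y <= x /\ `|x - y| = x - y).
  case: (leP x y) => [xy|/ltW yx]; [left|right]; split => //.
    by rewrite ler0_norm ?subr_le0// opprB.
  by rewrite ger0_norm ?subr_ge0.
case: (ltP K x) => Kx; case: (ltP K y) => Ky.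
- by case: xyE => -[xy ->]; lra.
- by case: xyE => -[xy ->]; lra.
- by case: xyE => -[xy ->]; lra.
- rewrite xyab !add0r ler_wpM2r// expr2 ler_pM//; lra.
Qed.

(** This replaces weak compactness. As E[1/(1+f)] is strictly convex in f >= 0,
    almost-minimisers taken in the successive sets are close to each other in
    measure: the midpoint of two of them lies in one of the sets, hence cannot do
    much better. Uniform integrability turns this into closeness in L^1. *)
Lemma midpoint_convex_compact (C : nat -> set (T -> R)) :
  (forall n, C n !=set0) -> (forall n, C n.+1 `<=` C n) ->
  (forall n f g, C n f -> C n g -> C n (fun w => (f w + g w) / 2)) ->
  (forall f, C 0%N f -> \forall w \ae P, 0 <= f w) ->
  uniformly_integrable P (C 0%N) ->
  exists (f_ : nat -> T -> R) f, [/\ forall n, C n (f_ n), integrable f &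
    \E (fun w => `|f_ n w - f w|) @[n --> \oo] --> (0 : R)].
Proof.
move=> C_ne CS Cmid C0_ge0 /uniformly_integrableP[C0i C0K].
have Cle m n : (m <= n)%N -> C n `<=` C m.
  elim: n => [|n IH]; first by rewrite leqn0 => /eqP->.
  rewrite leq_eqVlt => /predU1P[->//|/IH h].
  by apply: subset_trans h; exact: CS.
pose a f w : R := (1 + `|f w|)^-1.
have a01 f w : 0 <= a f w <= 1.
  by rewrite /a invr_ge0 addr_ge0//= invf_le1 ?lerDl// ltr_pwDl.
have ai f : integrable f -> integrable (a f).
  move=> fi; apply: (@bounded_integrable _ _ _ P _ 1); last first.
    by apply: nearW => w; have /andP[? ?] := a01 f w; rewrite ger0_norm.
  have mf := integrable_measurable fi.
  apply: (@measurableT_comp _ _ _ _ _ _ (fun x : R => (1 + `|x|)^-1)) => //.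
  apply: continuous_measurable_fun => x.
  apply: cvgV; first by rewrite gt_eqF// ltr_pwDl.
  by apply: cvgD; [exact: cvg_cst|exact: cvg_norm].
pose J f := \E (a f).
have J01 f : integrable f -> 0 <= J f <= 1.
  move=> fi; apply/andP; split.
    by apply: Rintegral_ge0 => w _; have /andP[] := a01 f w.
  rewrite -(expect_cst P 1); apply: le_expect; [exact: ai|exact: integrable_cst_fun|].
  by move=> w; have /andP[] := a01 f w.
have CiJ n f : C n f -> integrable f by move=> /(Cle 0%N n (leq0n _))/C0i.
pose I n := inf [set J f | f in C n].
have Jinf n : has_inf [set J f | f in C n].
  split; first by have [f Cf] := C_ne n; exists (J f), f.
  by exists 0 => _ [f /CiJ fi <-]; have /andP[] := J01 f fi.
have IJ n f : C n f -> I n <= J f.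
  by move=> Cf; apply: ge_inf; [exact: (Jinf n).2|exists f].
have In1 n : I n <= 1.
  have [f Cf] := C_ne n; apply: (le_trans (IJ _ _ Cf)).
  by have /andP[] := J01 _ (CiJ _ _ Cf).
have Ind m n : (m <= n)%N -> I m <= I n.
  move=> mn; apply: lb_le_inf; first exact: (Jinf n).1.
  by move=> _ [f Cf <-]; apply: IJ; exact: Cle Cf.
pose s := sup (range I).
have Isup : has_sup (range I).
  by split; [exists (I 0%N), 0%N|exists 1 => _ [n _ <-]].
have Is n : I n <= s by apply: ub_le_sup; [exact: Isup.2|exists n].
have /choice[f_ f_P] n : exists f, C n f /\ J f < I n + (2^-1 : R) ^+ n.
  have [|_ [f Cf <-] Jf] := @inf_adherent _ _ ((2^-1 : R) ^+ n) _ (Jinf n).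
    by rewrite exprn_gt0.
  by exists f.
have f_C n : C n (f_ n) by have [] := f_P n.
have f_i n : integrable (f_ n) by exact: CiJ (f_C n).
have f_0 n : \forall w \ae P, 0 <= f_ n w by apply: C0_ge0; exact: Cle (f_C n).
suff [f fi ff] : exists2 f, integrable f &
    \E (fun w => `|f_ n w - f w|) @[n --> \oo] --> (0 : R) by exists f_, f.
apply: L1_complete => // e4 e40.
pose e := e4 / 4; have e0 : 0 < e by rewrite divr_gt0.
have [K0 K0P] := C0K _ e0.
pose K := Num.max 0 K0.
have KP n : \E (tail K (f_ n)) <= e.
  have Cf : C 0%N (f_ n) by exact: Cle (f_C n).
  apply: le_trans (K0P _ Cf); apply: le_expect => [||w].
  - exact: tail_integrable.
  - exact: tail_integrable.
  - by rewrite tail_le// le_max lexx orbT.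
have KK0 : 0 <= K by rewrite le_max lexx.
pose M := (1 + K) ^+ 2; have M0 : 0 < M by rewrite exprn_gt0//; lra.
(* The thresholds make each of the four error terms at most e. *)
pose r := e / M; have r0 : 0 < r by rewrite divr_gt0.
pose eta := r ^+ 2 / 8; have eta0 : 0 < eta by rewrite divr_gt0// exprn_gt0.
have [_ [N0 _ <-] N0P] := sup_adherent eta0 Isup.
have [N1 N1P] := halves_lt eta0.
exists (maxn N0 N1) => n m; rewrite !geq_max => /andP[n0 n1] /andP[m0 m1].
pose h w := (f_ n w + f_ m w) / 2.
have Ch : C N0 h by apply: Cmid; exact: Cle (f_C _).
have hi : integrable h by exact: CiJ Ch.
have Jle k : (N1 <= k)%N -> J (f_ k) <= s + eta.
  move=> k1; have [_ /ltW/le_trans] := f_P k; apply.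
  apply: lerD; first exact: Is.
  by apply: le_trans (ltW N1P); rewrite ler_wiXn2l// invf_le1// ler1n.
have gapJ : (J (f_ n) + J (f_ m)) / 2 - J h <= 2 * eta.
  by have := Jle _ n1; have := Jle _ m1; have := IJ _ _ Ch; move: N0P; rewrite -/s; lra.
pose D w := 2^-1 * (a (f_ n) w + a (f_ m) w) - a h w.
have sumi : integrable (fun w => a (f_ n) w + a (f_ m) w).
  by apply: integrableDr; exact: ai.
have halfi : integrable (fun w => 2^-1 * (a (f_ n) w + a (f_ m) w)).
  exact: integrableZr_fun.
have Di : integrable D by apply: integrableBr => //; exact: ai.
have DE : \E D = (J (f_ n) + J (f_ m)) / 2 - J h.
  by rewrite expectB//; [rewrite expectZ// expectD; [rewrite mulrC|exact: ai|exact: ai]|exact: ai].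
pose tn := tail K (f_ n); pose tm := tail K (f_ m).
have tni : integrable tn by exact: tail_integrable.
have tmi : integrable tm by exact: tail_integrable.
have tti : integrable (fun w => tn w + tm w) by exact: integrableDr.
have rDi : integrable (fun w => 4 / r * D w) by exact: integrableZr_fun.
have crDi : integrable (fun w => r + 4 / r * D w).
  by apply: integrableDr => //; exact: integrable_cst_fun.
have MrDi : integrable (fun w => M * (r + 4 / r * D w)) by exact: integrableZr_fun.
apply: (@le_trans _ _ (\E (fun w => tn w + tm w + M * (r + 4 / r * D w)))).
  apply: ae_le_expect.
  - by apply: integrable_normr; exact: integrableBr.
  - exact: integrableDr.
  - apply: filterS2 (f_0 n) (f_0 m) => w fn0 fm0.
    have := inv1_gap fn0 fm0 KK0 r0.
    rewrite /tn /tm /tail /D /a /h (ger0_norm fn0) (ger0_norm fm0).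
    rewrite (@ger0_norm _ ((f_ n w + f_ m w) / 2)); last lra.
    by rewrite [2^-1 * _]mulrC.
rewrite expectD// expectD// expectZ// expectD//; last exact: integrable_cst_fun.
rewrite expect_cst expectZ// DE.
have r8 : 4 / r * ((J (f_ n) + J (f_ m)) / 2 - J h) <= r.
  apply: (@le_trans _ _ (4 / r * (2 * eta))).
    by apply: ler_wpM2l => //; rewrite divr_ge0// ltW.
  rewrite /eta (_ : 4 / r * _ = r)//; field; by rewrite gt_eqF.
have Mr : M * (r + 4 / r * ((J (f_ n) + J (f_ m)) / 2 - J h)) <= M * (r + r).
  by rewrite ler_wpM2l ?lerD2l// ltW.
have Mre : M * (r + r) = 2 * e by rewrite /r; field; rewrite gt_eqF.
have := KP n; have := KP m; rewrite -/tn -/tm.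
have -> : e4 = 4 * e by rewrite /e; field.
move: Mr; rewrite Mre; lra.
Qed.

End uniform_integrability.

(** * Conjugates of monotone functions on bounded random variables *)

Section Lebesgue_spaces.
Context {d : measure_display} {T : measurableType d} {R : realType}.
Variable P : probability T R.
Implicit Types (f g : T -> R) (Y : Linfty P) (Z : L1 P).

Local Notation integrable f := (P.-integrable [set: T] (EFin \o f)).
Local Notation "\E f" := (Rintegral P setT f) (at level 10, f at level 8).

Lemma ae_bounded_Linfty f (K : R) : measurable_fun [set: T] f ->
  (\forall w \ae P, `|f w| <= K) ->
  ('N[P]_+oo[EFin \o f] <= K%:E)%E /\ exists Y, (Y : T -> R) = f.
Proof.
move=> mf fK.
have NK : ('N[P]_+oo[EFin \o f] <= K%:E)%E.
  rewrite unlock /= probability_setT lte01; apply/ess_supP.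
  by apply: filterS fK => w h; rewrite /= lee_fin.
split=> //.
have fL : f \in Lfun P +oo%E.
  apply/andP; split; rewrite inE//=.
  by rewrite /finite_norm (le_lt_trans NK)// ltry.
by exists (Lfun_Sub (leey 1) fL).
Qed.

Lemma Linfty_ae_bounded Y : exists2 K : R, 0 <= K & \forall w \ae P, `|Y w| <= K.
Proof.
have := @Lfunction_finite _ _ _ _ _ _ Y.
rewrite /finite_norm unlock /= probability_setT lte01 => Yoo.
have YK := ess_sup_ge P (abse \o (EFin \o Y)).
move: Yoo YK; set s := ess_sup _ _; case: s => [K _ YK|//|_ YK].
  exists `|K| => //; apply: filterS YK => w /=; rewrite lee_fin => h.
  exact: le_trans h (ler_norm _).
by exists 0 => //; apply: filterS YK.
Qed.

Lemma measurable_Linfty Y : measurable_fun [set: T] Y.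
Proof. exact: measurable_funPT. Qed.

Lemma L1_integrable Z : integrable Z.
Proof. by apply/Lfun1_integrable; exact: LfunP. Qed.

Lemma integrable_L1 f : integrable f -> exists Z, (Z : T -> R) = f.
Proof. by move=> /Lfun1_integrable fL; exists (Lfun_Sub (lexx 1%E) fL). Qed.

Lemma integrable_Linfty_mul Y f : integrable f -> integrable (fun w => Y w * f w).
Proof.
move=> fi; have [K K0 YK] := Linfty_ae_bounded Y.
apply: (ae_le_integrable (g := fun w => K * `|f w|)).
- by apply: measurable_funM (integrable_measurable fi); exact: measurable_Linfty.
- by apply: integrableZr_fun; exact: integrable_normr.
- by apply: filterS YK => w h; rewrite normrM ler_wpM2r.
Qed.

Lemma expect_le0_ae_eq0 f : integrable f -> (forall w, 0 <= f w) -> \E f <= 0 ->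
  \forall w \ae P, f w = 0.
Proof.
move=> fi f0 Ef.
have : (\int[P]_w `|(EFin \o f) w| = 0)%E.
  under eq_integral do rewrite /= ger0_norm//.
  have := integrable_expect fi; rewrite unlock => ->; congr _%:E.
  by apply/eqP; rewrite eq_le Ef; exact: Rintegral_ge0.
move/(ae_eq_integral_abs P measurableT (measurable_int _ fi)).
by apply: filterS => w /(_ I)[].
Qed.

End Lebesgue_spaces.

Section conjugate_function.
Context {d : measure_display} {T : measurableType d} {R : realType}.
Context {P : probability T R}.
Variable phi : Linfty P -> R.
Hypothesis phi_mon : Defs.monotone phi.
Hypothesis phi_Leb : Lebesgue_property phi.
Hypothesis phi0 : phi 0 = 0.
Implicit Types (f g : T -> R) (Y : Linfty P) (Z : L1 P).

Local Notation integrable f := (P.-integrable [set: T] (EFin \o f)).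
Local Notation "\E f" := (Rintegral P setT f) (at level 10, f at level 8).

(** The conjugate is at most [c] iff [Z], as an affine function with constant
    [- c], lies below [phi]; all later facts on the conjugate go through this
    real-valued form. *)
Lemma conj_leP Z (c : R) : (conj_phi phi Z <= c%:E)%E <->
  forall Y, \E (fun w => Y w * Z w) <= phi Y + c.
Proof.
have E Y : ('E_P[Y \* Z] - (phi Y)%:E)%E = (\E (fun w => Y w * Z w) - phi Y)%:E.
  rewrite EFinB -integrable_expect//; apply: integrable_Linfty_mul.
  exact: L1_integrable.
split=> [h Y|h].
  rewrite -lerBlDl -lee_fin -E; apply: le_trans h.
  by apply: ereal_sup_ubound; exists Y.
by apply: ge_ereal_sup => _ [Y _ <-]; rewrite E lee_fin lerBlDl.
Qed.

Lemma conj_ge0 Z : (0 <= conj_phi phi Z)%E.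
Proof.
apply: ereal_sup_ubound; exists 0 => //.
rewrite phi0 sube0 (_ : _ \* _ = cst 0) ?expectation_cst//.
by apply/funext => w; rewrite /= mul0r.
Qed.

(** Takes the junk value 0 outside the domain of the conjugate. *)
Definition conjr Z := fine (conj_phi phi Z).

Lemma dom_conjE Z : dom_conj phi Z -> conj_phi phi Z = (conjr Z)%:E.
Proof. by move=> Zd; rewrite fineK// ge0_fin_numE// conj_ge0. Qed.

Lemma conjr_ge0 Z : 0 <= conjr Z.
Proof. by apply: fine_ge0; exact: conj_ge0. Qed.

Lemma conj_le_dom Z (c : R) : (conj_phi phi Z <= c%:E)%E -> dom_conj phi Z.
Proof. by move=> h; apply: le_lt_trans h _; rewrite ltry. Qed.

Lemma fenchel_young Z Y : dom_conj phi Z ->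
  \E (fun w => Y w * Z w) <= phi Y + conjr Z.
Proof.
move=> /dom_conjE ZE.
by have /conj_leP/(_ Y) : (conj_phi phi Z <= (conjr Z)%:E)%E by rewrite ZE.
Qed.

(** Testing [Z] against -t 1_(Z < 0), where [phi] is at most 0 by
    monotonicity, bounds t E[Z^-] by the conjugate for all t > 0. *)
Lemma dom_conj_ae_ge0 Z : dom_conj phi Z -> \forall w \ae P, 0 <= Z w.
Proof.
move=> Zd; pose N w := Num.max (- Z w) 0.
have Zi := L1_integrable Z; have mZ := integrable_measurable Zi.
have mN : measurable_fun [set: T] N.
  by apply: measurable_maxr => //; exact: measurableT_comp.
have N0 w : 0 <= N w by rewrite le_max lexx orbT.
have Ni : integrable N.
  apply: (ae_le_integrable mN (integrable_normr Zi)); apply: nearW => w.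
  by rewrite ger0_norm// ge_max normr_ge0 -normrN ler_norm.
pose A := [set w | Z w < 0].
have mA : measurable A.
  have mK : measurable_fun [set: T] (fun w => Z w < 0) by exact: measurable_fun_ltr.
  by rewrite -[A]setTI; exact: (mK measurableT [set true]).
have bound t : 0 < t -> t * \E N <= conjr Z.
  move=> t0.
  have [||_ [Y YE]] := @ae_bounded_Linfty _ _ _ P (fun w => - t * \1_A w) t.
  - by apply: measurable_funM => //; exact: measurable_indic.
  - apply: nearW => w; rewrite normrM normrN (gtr0_norm t0) indicE.
    by case: (w \in A); rewrite ?normr1 ?normr0 ?mulr1 ?mulr0// ltW.
  have Y0 : phi Y <= 0.
    rewrite -phi0; apply: phi_mon; apply: nearW => w.
    rewrite YE (_ : (0 : Linfty P) w = 0)//.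
    by rewrite indicE mulNr oppr_le0 mulr_ge0// ltW.
  rewrite -expectZ//; apply: le_trans (_ : phi Y + conjr Z <= _); last first.
    by rewrite gerDr.
  apply: le_trans (fenchel_young Y Zd); rewrite le_eqVlt; apply/orP; left; apply/eqP.
  apply: eq_Rintegral => w _; rewrite YE indicE /N.
  case: (ltP (Z w) 0) => Zw.
    rewrite mem_set// (_ : Num.max _ _ = - Z w) ?mulr1 ?mulrN ?mulNr//.
    by apply/max_idPl; rewrite oppr_ge0 ltW.
  rewrite memNset ?mulr0 ?mul0r; last by move=> /lt_geF; rewrite Zw.
  by rewrite (_ : Num.max _ _ = 0) ?mulr0//; apply/max_idPr; rewrite oppr_le0.
have EN : \E N <= 0.
  rewrite leNgt; apply/negP => EN.
  have c0 := conjr_ge0 Z.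
  have := bound ((conjr Z + 1) / \E N); rewrite divfK ?gt_eqF// => /(_ _).
  by rewrite divr_gt0; lra.
apply: filterS (expect_le0_ae_eq0 Ni N0 EN) => w Nw.
have : - Z w <= N w by rewrite le_max lexx.
by rewrite Nw oppr_le0.
Qed.

Lemma conj_midpoint Z1 Z2 Z (c1 c2 : R) :
  (conj_phi phi Z1 <= c1%:E)%E -> (conj_phi phi Z2 <= c2%:E)%E ->
  (forall w, Z w = (Z1 w + Z2 w) / 2) -> (conj_phi phi Z <= ((c1 + c2) / 2)%:E)%E.
Proof.
move=> /conj_leP h1 /conj_leP h2 ZE; apply/conj_leP => Y.
have i1 := integrable_Linfty_mul Y (L1_integrable Z1).
have i2 := integrable_Linfty_mul Y (L1_integrable Z2).
have -> : \E (fun w => Y w * Z w) =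
    2^-1 * (\E (fun w => Y w * Z1 w) + \E (fun w => Y w * Z2 w)).
  rewrite -expectD// -expectZ//; last exact: integrableDr.
  by apply: eq_Rintegral => w _; rewrite ZE; field.
by have := h1 Y; have := h2 Y; lra.
Qed.

Lemma cst_Linfty (k : R) : exists Y, (Y : T -> R) = fun _ => k.
Proof.
by have [||] := @ae_bounded_Linfty _ _ _ P (fun _ => k) `|k|; [|exact: nearW|].
Qed.

End conjugate_function.

(** * Densities of order continuous positive forms *)

Section order_continuous_forms.
Import HBNNSimple.
Context {d : measure_display} {T : measurableType d} {R : realType}.
Variable P : probability T R.
Variable l : Linfty P -> R.
Hypothesis l_lin : forall (k : R) (Y Y' : Linfty P), l (k *: Y + Y') = k * l Y + l Y'.
Hypothesis l_ge0 : forall Y : Linfty P, (forall w, 0 <= Y w) -> 0 <= l Y.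
Hypothesis l_cont : forall Y_ : nat -> Linfty P,
  (forall n w, 0 <= Y_ n w <= 1) -> (forall w, Y_ n w @[n --> \oo] --> (0 : R)) ->
  l (Y_ n) @[n --> \oo] --> (0 : R).
Hypothesis l_null : forall Y : Linfty P, (\forall w \ae P, Y w = 0) -> l Y = 0.

Local Notation integrable f := (P.-integrable [set: T] (EFin \o f)).
Local Notation "\E f" := (Rintegral P setT f) (at level 10, f at level 8).

Let l0 : l 0 = 0.
Proof. by apply: l_null; exact: nearW. Qed.

Let lD Y Y' : l (Y + Y') = l Y + l Y'.
Proof. by rewrite -[Y in LHS]scale1r l_lin mul1r. Qed.

Let lZ k Y : l (k *: Y) = k * l Y.
Proof. by rewrite -[_ *: _]addr0 l_lin l0 addr0. Qed.

Let lB Y Y' : l (Y - Y') = l Y - l Y'.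
Proof. by rewrite lD -scaleN1r lZ mulN1r. Qed.

Let lsum n (F : nat -> Linfty P) : l (\sum_(0 <= i < n) F i) = \sum_(0 <= i < n) l (F i).
Proof. by elim: n => [|n IH]; rewrite ?big_nil// !big_nat_recr//= lD IH. Qed.

(* Nonnegativity is asserted at all sets, because the measure built from the form
   has to be nonnegative at nonmeasurable sets as well. *)
Let indicator_ex (A : set T) : exists Y : Linfty P, (forall w, 0 <= Y w) /\
  (measurable A -> (Y : T -> R) = \1_A).
Proof.
have [mA|nA] := pselect (measurable A); last by exists 0; split.
have [|_ [Y YE]] := @ae_bounded_Linfty _ _ _ P (\1_A) 1 (measurable_indic mA).
  by apply: nearW => w; rewrite indicE; case: (w \in A); rewrite ?normr1 ?normr0.
by exists Y; split => // w; rewrite YE indicE.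
Qed.

Let ind A : Linfty P := sval (cid (indicator_ex A)).
Let ind_ge0 A w : 0 <= ind A w. Proof. by rewrite /ind; case: cid => ? []. Qed.
Let indE A : measurable A -> (ind A : T -> R) = \1_A.
Proof. by rewrite /ind; case: cid => ? []. Qed.

Let nu (A : set T) : \bar R := (l (ind A))%:E.

Let nu0 : nu set0 = 0%E.
Proof.
congr _%:E; apply: l_null; apply: nearW => w.
by rewrite indE ?indic0.
Qed.

Let nu_ge0 A : (0 <= nu A)%E.
Proof. by rewrite lee_fin; apply: l_ge0; exact: ind_ge0. Qed.

Lemma sum_indic_trivIset (F : (set T)^nat) k n w : trivIset setT F -> F k w ->
  \sum_(0 <= i < n) \1_(F i) w = (k < n)%N%:R :> R.
Proof.
move=> tF Fkw; elim: n => [|n IH]; first by rewrite big_nil.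
rewrite big_nat_recr//= IH indicE (ltnS k n) (leq_eqVlt k n).
have [<-|kn] /= := eqVneq k n; first by rewrite ltnn mem_set// add0r.
rewrite memNset ?addr0// => Fnw.
by move/eqP: kn; apply; apply: (tF k n) => //; exists w.
Qed.

Let nu_semi_sigma_additive : semi_sigma_additive nu.
Proof.
move=> F mF tF mUF.
pose D n : Linfty P := ind (\bigcup_n F n) - \sum_(0 <= i < n) ind (F i).
have DE n w : D n w = \1_(\bigcup_n F n) w - \sum_(0 <= i < n) \1_(F i) w.
  rewrite /D -[LHS]/(ind (\bigcup_n F n) w - (\sum_(0 <= i < n) ind (F i) : Linfty P) w).
  rewrite indE//; congr (_ - _).
  elim: n {D} => [|n IH]; first by rewrite !big_nil.
  rewrite !big_nat_recr//= -IH -[LHS]/((\sum_(0 <= i < n) ind (F i) : Linfty P) w + ind (F n) w).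
  by rewrite (indE (mF n)).
have Din k n w : F k w -> D n w = 1 - (k < n)%N%:R.
  by move=> Fkw; rewrite DE (sum_indic_trivIset _ tF Fkw) indicE mem_set//; exists k.
have Dout n w : ~ (\bigcup_n F n) w -> D n w = 0.
  move=> Fw; rewrite DE indicE memNset// big1 ?subr0// => i _.
  by rewrite indicE memNset// => Fiw; apply: Fw; exists i.
have D0 : l (D n) @[n --> \oo] --> (0 : R).
  apply: (@l_cont D) => [n w|w].
    have [[k _ Fkw]|Fw] := pselect ((\bigcup_n F n) w).
      have -> := Din k n w Fkw; case: (k < n)%N; by rewrite ?subrr ?subr0 lexx ler01.
    by rewrite Dout// lexx ler01.
  have [[k _ Fkw]|Fw] := pselect ((\bigcup_n F n) w).
    apply: cvg_near_cst; exists k.+1 => // n /= kn.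
    by rewrite -[LHS]/(D n w) (Din k)// kn subrr.
  by apply: cvg_near_cst; apply: nearW => n; exact: Dout.
apply: cvg_EFin; first by apply: nearW => n; rewrite sumEFin.
have -> : fine \o (fun n => \sum_(0 <= i < n) nu (F i))%E =
    (fun n => l (ind (\bigcup_n F n)) - l (D n)).
  by apply/funext => n; rewrite /= sumEFin/= lB lsum opprB addrC subrK.
rewrite -[X in _ --> X]subr0; apply: cvgB => //; exact: cvg_cst.
Qed.

HB.instance Definition _ := isMeasure.Build _ _ _ nu nu0 nu_ge0 nu_semi_sigma_additive.

Let nu_fin : fin_num_fun nu. Proof. by []. Qed.

HB.instance Definition _ := @Measure_isFinite.Build _ _ _ nu nu_fin.

Let density : exists2 f : T -> R, integrable f &
  forall A, measurable A -> l (ind A) = \E (fun w => \1_A w * f w).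
Proof.
have numu : nu `<< P.
  apply/null_content_dominatesP => A mA PA; congr _%:E; apply: l_null.
  exists A; split => // w /= wA; apply: contrapT => Aw; apply: wA.
  by rewrite indE// indicE memNset.
have [f [f0 ffin fi fE]] := radon_nikodym_sigma_finite numu.
have fiE : EFin \o (fine \o f) = f by apply/funext => w /=; rewrite fineK.
exists (fine \o f); first by rewrite fiE.
move=> A mA; have := fE _ mA; rewrite /nu /= => /(congr1 fine) /= ->.
rewrite /Rintegral; congr fine; rewrite [LHS]integral_mkcond.
apply: eq_integral => w _.
rewrite patchE indicE; case: ifPn => wA; last by rewrite mul0r.
by rewrite mul1r /= fineK.
Qed.

(** The form defines a finite measure by its values on indicators, null on
    negligible sets; its Radon-Nikodym density represents the form on indicators
    and, by linearity, on simple functions. *)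
Lemma order_continuous_form_density : exists2 f : T -> R, integrable f &
  forall s : {nnsfun T >-> R}, exists2 Y : Linfty P, (Y : T -> R) = s &
    l Y = \E (fun w => s w * f w).
Proof.
have [f fi fE] := density; exists f => // s.
have indi A : measurable A -> integrable (fun w => \1_A w * f w).
  by move=> mA; rewrite -indE//; exact: integrable_Linfty_mul.
pose vals : seq R := finmap.enum_fset (fset_set (range s)).
suff [Y YE lY] : exists2 Y : Linfty P,
    (Y : T -> R) = (fun w => \sum_(y <- vals) (y * \1_(s @^-1` [set y]) w)) &
    l Y = \E (fun w => (\sum_(y <- vals) (y * \1_(s @^-1` [set y]) w)) * f w).
  have sE : (fun w => \sum_(y <- vals) (y * \1_(s @^-1` [set y]) w)) = s.
    by apply/funext => w; rewrite [RHS]fimfunE fsbig_finite.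
  exists Y; first by rewrite YE.
  by rewrite lY; apply: eq_Rintegral => w _; rewrite -[in RHS]sE.
elim: vals => [|y r [Y YE lY]].
  exists 0; first by apply/funext => w; rewrite big_nil.
  rewrite l0 (_ : (fun _ => _) = fun _ => 0) ?expect_cst//.
  by apply/funext => w; rewrite big_nil mul0r.
have mA : measurable (s @^-1` [set y]) by exact: measurable_sfunP.
exists (y *: ind (s @^-1` [set y]) + Y).
  apply/funext => w; rewrite big_cons.
  by rewrite -[LHS]/(y * ind (s @^-1` [set y]) w + Y w) YE indE.
have Yi : integrable (fun w => Y w * f w) by exact: integrable_Linfty_mul.
rewrite l_lin lY fE// -expectZ ?indi// -expectD.
- by apply: eq_Rintegral => w _; rewrite big_cons mulrDl mulrA.
- by apply: integrableZr_fun; exact: indi.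
- by rewrite YE in Yi.
Qed.

End order_continuous_forms.

(** * Sublevel sets of the conjugate under the Lebesgue property *)

Section dual_sublevels.
Import HBNNSimple.
Context {d : measure_display} {T : measurableType d} {R : realType}.
Context {P : probability T R}.
Variable phi : Linfty P -> R.
Hypothesis phi_mc : monotone_convex phi.
Hypothesis phi_Leb : Lebesgue_property phi.
Hypothesis phi0 : phi 0 = 0.
Implicit Types (f g : T -> R) (Y : Linfty P) (Z : L1 P).

Local Notation integrable f := (P.-integrable [set: T] (EFin \o f)).
Local Notation "\E f" := (Rintegral P setT f) (at level 10, f at level 8).

Lemma monotone_convex_fun : convex_fun phi.
Proof.
move=> Y Y' t /andP[t0 t1].
have := phi_mc.2 (Itv01 t0 t1) Y Y'; rewrite !inE => /(_ I I).
by rewrite convRE.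
Qed.

Lemma bounded_Lebesgue (Y_ : nat -> Linfty P) Y (K : R) :
  (forall n, \forall w \ae P, `|Y_ n w| <= K) ->
  (\forall w \ae P, Y_ n w @[n --> \oo] --> Y w) ->
  phi (Y_ n) @[n --> \oo] --> phi Y.
Proof.
move=> YK YY; apply: phi_Leb => //; apply: (@le_lt_trans _ _ K%:E); last exact: ltry.
apply: ge_ereal_sup => _ [n _ <-].
by have [] := ae_bounded_Linfty (measurable_Linfty (Y_ n)) (YK n).
Qed.

(** Duality at the origin: a linear minorant of [phi] is positive and order
    continuous, hence has a density [Z]. The inequality E[Y Z] <= phi(Y), known
    for differences of simple functions, extends to all bounded [Y] by the
    Lebesgue property. *)
Lemma exists_dual_zero : exists Z, (conj_phi phi Z <= 0)%E.
Proof.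
have [l l_lin l_phi] := exists_linear_minorant monotone_convex_fun phi0.
have lN Y : l (- Y) = - l Y.
  have l0 : l 0 = 0 by have := l_lin 1 0 0; rewrite scaler0 addr0; lra.
  by have := l_lin (-1) Y 0; rewrite scaleN1r addr0 l0 addr0 mulN1r.
have l_ge0 Y : (forall w, 0 <= Y w) -> 0 <= l Y.
  move=> Y0; rewrite -oppr_le0 -lN (le_trans (l_phi _))// -phi0.
  by apply: phi_mc.1; apply: nearW => w; rewrite -[leLHS]/(- Y w) oppr_le0.
have l_null Y : (\forall w \ae P, Y w = 0) -> l Y = 0.
  move=> Y0; apply/eqP; rewrite eq_le; apply/andP; split.
    rewrite (le_trans (l_phi _))// -phi0; apply: phi_mc.1.
    by apply: filterS Y0 => w ->.
  rewrite -oppr_le0 -lN (le_trans (l_phi _))// -phi0; apply: phi_mc.1.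
  by apply: filterS Y0 => w Yw; rewrite -[leLHS]/(- Y w) Yw oppr0.
have l_cont (Y_ : nat -> Linfty P) : (forall n w, 0 <= Y_ n w <= 1) ->
    (forall w, Y_ n w @[n --> \oo] --> (0 : R)) -> l (Y_ n) @[n --> \oo] --> (0 : R).
  move=> Y01 Y0; apply: (@squeeze_cvgr _ _ _ _ (fun=> 0) (fun n => phi (Y_ n))).
  - apply: nearW => n; rewrite l_phi andbT; apply: l_ge0 => w.
    by have /andP[] := Y01 n w.
  - exact: cvg_cst.
  - rewrite -phi0; apply: (@bounded_Lebesgue _ _ 1).
    + move=> n; apply: nearW => w.
      by have /andP[? ?] := Y01 n w; rewrite ger0_norm.
    + by apply: nearW => w; exact: Y0.
have [f fi fE] := order_continuous_form_density l_lin l_ge0 l_cont l_null.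
have [Z ZE] := integrable_L1 fi; exists Z; apply/conj_leP => Y; rewrite addr0.
have [K K0 YK] := Linfty_ae_bounded Y.
have mY := measurable_Linfty Y.
pose yp w := Num.max (Y w) 0; pose ym w : R := Num.max (- Y w) 0.
have mp : measurable_fun [set: T] yp by exact: measurable_maxr.
have mm : measurable_fun [set: T] ym.
  by apply: measurable_maxr => //; exact: measurableT_comp.
have approx (y : T -> R) : measurable_fun [set: T] y -> (forall w, 0 <= y w <= `|Y w|) ->
    exists S_ : nat -> Linfty P, [/\ forall n w, 0 <= S_ n w <= y w,
      forall w, S_ n w @[n --> \oo] --> y w & l (S_ n) @[n --> \oo] --> \E (fun w => y w * Z w)].
  move=> my y0Y.
  have mEy : measurable_fun [set: T] (EFin \o y) by exact/measurable_EFinP.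
  pose s := nnsfun_approx measurableT mEy.
  have /choice[S_ SP] n : exists S : Linfty P,
      (S : T -> R) = s n /\ l S = \E (fun w => s n w * f w).
    by have [S SE lS] := fE (s n); exists S.
  have Ss n w : S_ n w = s n w by rewrite (SP n).1.
  have Sy w : S_ n w @[n --> \oo] --> y w.
    under eq_fun do rewrite Ss.
    have /fine_cvg : (s n w)%:E @[n --> \oo] --> (y w)%:E.
      by apply: (cvg_nnsfun_approx measurableT mEy) => // x _; have /andP[] := y0Y x.
    exact.
  have S01 n w : 0 <= S_ n w <= y w.
    rewrite Ss fun_ge0/= -Ss.
    have nd : nondecreasing_seq (fun n => S_ n w).
      by move=> a b ab; rewrite !Ss; exact/lefP/nd_nnsfun_approx.
    rewrite -(cvg_lim (@Rhausdorff R) (Sy w)).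
    by apply: nondecreasing_cvgn_le => //; apply: cvgP (Sy w).
  exists S_; split => //.
  have -> : (fun n => l (S_ n)) = (fun n => \E (fun w => S_ n w * Z w)).
    apply/funext => n; rewrite (SP n).2; apply: eq_Rintegral => w _.
    by rewrite Ss ZE.
  have mZ := integrable_measurable (L1_integrable Z).
  have KZi : integrable (fun w => K * `|Z w|).
    by apply: integrableZr_fun; apply: integrable_normr; exact: L1_integrable.
  have [||||_ _ //] := @expect_dominated_cvg _ _ _ P (fun n w => S_ n w * Z w)
      (fun w => y w * Z w) (fun w => K * `|Z w|) _ _ _ KZi.
  - by move=> n; apply: measurable_funM mZ; exact: measurable_Linfty.
  - exact: measurable_funM.
  - by apply: nearW => w; apply: cvgMl; exact: Sy.
  - apply: filterS YK => w Yw n; rewrite normrM ler_wpM2r//.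
    have /andP[Sw0 Swy] := S01 n w; rewrite ger0_norm// (le_trans Swy)//.
    by have /andP[_] := y0Y w; move/le_trans; apply.
have [|Sp [Sp0 Spy lp]] := approx yp mp.
  by move=> w; rewrite /yp le_max lexx orbT/= ge_max ler_norm normr_ge0.
have [|Sm [Sm0 Smy lm]] := approx ym mm.
  by move=> w; rewrite /ym le_max lexx orbT/= ge_max -normrN ler_norm normr_ge0.
have YE w : Y w = yp w - ym w.
  rewrite /yp /ym; case: (leP (Y w) 0) => Yw.
    by rewrite max_l ?oppr_ge0// sub0r opprK.
  by rewrite max_r ?subr0// oppr_le0 ltW.
have yppm w : yp w <= `|Y w| /\ ym w <= `|Y w|.
  by rewrite /yp /ym !ge_max !normr_ge0 !andbT ler_norm -normrN ler_norm.
have lB Y1 Y2 : l (Y1 - Y2) = l Y1 - l Y2.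
  have l0 : l 0 = 0 by have := l_lin 1 0 0; rewrite scaler0 addr0; lra.
  by have := l_lin 1 Y1 (- Y2); rewrite scale1r lN mul1r.
have phi_lim : phi (Sp n - Sm n) @[n --> \oo] --> phi Y.
  apply: (@bounded_Lebesgue _ _ K).
    move=> n; apply: filterS YK => w Yw; rewrite -[X in `|X|]/(Sp n w - Sm n w).
    have /andP[? ?] := Sp0 n w; have /andP[? ?] := Sm0 n w.
    by have [? ?] := yppm w; rewrite ler_norml; apply/andP; split; lra.
  by apply: nearW => w; rewrite YE; apply: cvgB; [exact: Spy|exact: Smy].
have yi (y : T -> R) : measurable_fun [set: T] y -> (forall w, `|y w| <= `|Y w|) ->
    integrable (fun w => y w * Z w).
  move=> my yY; have YZi := integrable_Linfty_mul Y (L1_integrable Z).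
  apply: (ae_le_integrable _ (integrable_normr YZi)).
    by apply: measurable_funM => //; exact: integrable_measurable (L1_integrable Z).
  by apply: nearW => w; rewrite !normrM ler_wpM2r.
have EY : \E (fun w => Y w * Z w) = \E (fun w => yp w * Z w) - \E (fun w => ym w * Z w).
  rewrite -expectB.
  - by apply: eq_Rintegral => w _; rewrite YE mulrBl.
  - apply: yi => // w; rewrite ger0_norm ?(yppm w).1//.
    by rewrite /yp le_max lexx orbT.
  - apply: yi => // w; rewrite ger0_norm ?(yppm w).2//.
    by rewrite /ym le_max lexx orbT.
have l_lim : l (Sp n - Sm n) @[n --> \oo] -->
    \E (fun w => yp w * Z w) - \E (fun w => ym w * Z w).
  rewrite (_ : (fun n => l (Sp n - Sm n)) = (fun n => l (Sp n) - l (Sm n))).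
    exact: cvgB.
  by apply/funext => n; exact: lB.
by rewrite EY; apply: (ler_cvg_to l_lim phi_lim); exact: nearW.
Qed.

(** The Lebesgue property makes the dual sublevel sets uniformly integrable:
    if the tails over [Z_n > 2^n] kept mass e, then testing Z_n against
    multiples of the indicators of these sets, which converge to 0 a.s. by
    Borel-Cantelli, would contradict the Fenchel-Young inequality. *)
Lemma sublevel_uniformly_integrable (c : R) : 0 <= c ->
  uniformly_integrable P
    [set (Z : T -> R) | Z in [set Z : L1 P | (conj_phi phi Z <= c%:E)%E]].
Proof.
move=> c0; apply/uniformly_integrableP; split.
  by move=> _ [Z _ <-]; exact: L1_integrable.
move=> e e0; apply: contrapT => noK.
have /choice[Z_ ZP] n : exists Z, (conj_phi phi Z <= c%:E)%E /\
    e < \E (tail (2 ^+ n) Z).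
  apply: contrapT => noZ; apply: noK; exists (2 ^+ n) => _ [Z Zc <-].
  by rewrite leNgt; apply/negP => eZ; apply: noZ; exists Z.
have Zi n := L1_integrable (Z_ n).
have Z0 n := dom_conj_ae_ge0 phi_mc.1 phi0 (conj_le_dom (ZP n).1).
have [one oneE] := @cst_Linfty _ _ _ P 1.
pose B := phi one + c.
have EZ n : \E (fun w => `|Z_ n w|) <= B.
  rewrite (@ae_eq_expect _ _ _ P _ (fun w => one w * Z_ n w)).
  - by have /conj_leP := (ZP n).1; apply.
  - by apply: measurableT_comp => //; exact: integrable_measurable.
  - by apply: measurable_funM; [exact: measurable_Linfty|exact: integrable_measurable].
  - by apply: filterS (Z0 n) => w Zw; rewrite oneE mul1r ger0_norm.
pose A n := [set w | 2 ^+ n < `|Z_ n w|].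
have mA n : measurable (A n).
  by apply: measurable_norm_gt; exact: integrable_measurable.
have PA n : (P (A n) <= (B * 2^-1 ^+ n)%:E)%E.
  rewrite -expectation_indic// integrable_expect; last exact: integrable_indic.
  rewrite lee_fin mulrC.
  apply: (@le_trans _ _ (\E (fun w => 2^-1 ^+ n * `|Z_ n w|))).
    apply: le_expect.
    + exact: integrable_indic.
    + by apply: integrableZr_fun; exact: integrable_normr.
    + move=> w; rewrite indicE; case: (boolP (w \in A n)) => [|_].
        rewrite inE /A /= => /ltW h.
        by rewrite exprVn ler_pdivlMl ?exprn_gt0// mulr1.
      by rewrite mulr_ge0// exprn_ge0.
  rewrite expectZ; last exact: integrable_normr.
  by rewrite ler_wpM2l// exprn_ge0.
have B0 : 0 <= B by apply: le_trans (EZ 0%N); exact: Rintegral_ge0.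
have limA : P (lim_sup_set A) = 0%E.
  apply: lim_sup_set_cvg0 => //; apply: (@le_lt_trans _ _ (B * 2)%:E); last exact: ltry.
  apply: lime_le; first exact: is_cvg_nneseries.
  apply: nearW => n; apply: (@le_trans _ _ (\sum_(0 <= k < n) (B * 2^-1 ^+ k)%:E)%E).
    by apply: lee_sum => k _; exact: PA.
  by rewrite sumEFin lee_fin -mulr_sumr ler_wpM2l// sum_halves_le2.
(* With this factor E[a 1_(A n) Z_n] > 2 (1 + c), whereas the Fenchel-Young
   inequality bounds it by phi (a 1_(A n)) + c, eventually at most 1 + c. *)
pose a := 2 * (1 + c) / e.
have a0 : 0 < a by rewrite divr_gt0//; lra.
have aI_bd n : \forall w \ae P, `|a * \1_(A n) w| <= a.
  apply: nearW => w; rewrite normrM (gtr0_norm a0) indicE.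
  by case: (w \in A n); rewrite ?normr1 ?normr0 ?mulr1 ?mulr0// ltW.
have maI n : measurable_fun [set: T] (fun w => a * \1_(A n) w).
  by apply: measurable_funM => //; exact: measurable_indic.
have /choice[Y_ YE] n : exists Y, (Y : T -> R) = (fun w => a * \1_(A n) w).
  by have [] := ae_bounded_Linfty (maI n) (aI_bd n).
have Ylim : phi (Y_ n) @[n --> \oo] --> (0 : R).
  rewrite -phi0; apply: (@bounded_Lebesgue _ _ a).
    by move=> n; rewrite YE; exact: aI_bd.
  have mlim : measurable (lim_sup_set A).
    by apply: bigcap_measurable => // k _; apply: bigcup_measurable.
  exists (lim_sup_set A); split => // w; apply: contra_notP => wlim.
  have [N wN] : exists N, forall n, (N <= n)%N -> ~ A n w.
    apply: contrapT => h; apply: wlim => N _.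
    apply: contrapT => h'; apply: h; exists N => n Nn Anw; apply: h'.
    by exists n.
  apply: cvg_near_cst; exists N => // n /= Nn.
  by rewrite YE indicE memNset ?mulr0//; exact: wN.
have /cvgrPdist_lt/(_ 1 ltr01)[N _ /(_ N (leqnn _))] := Ylim.
rewrite /= sub0r normrN => /ltr_normlW YN.
have YZN : \E (fun w => Y_ N w * Z_ N w) = a * \E (tail (2 ^+ N) (Z_ N)).
  have ti := tail_integrable (2 ^+ N) (Zi N).
  rewrite -expectZ//; apply: ae_eq_expect.
  - by apply: measurable_funM; [exact: measurable_Linfty|exact: integrable_measurable].
  - by apply: measurable_funM => //; exact: integrable_measurable ti.
  - apply: filterS (Z0 N) => w Zw; rewrite YE -mulrA; congr (_ * _).
    by rewrite tail_indicE ger0_norm// mulrC.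
have := (conj_leP phi (Z_ N) c).1 (ZP N).1 (Y_ N); rewrite YZN => h.
have : a * e < a * \E (tail (2 ^+ N) (Z_ N)) by rewrite ltr_pM2l//; exact: (ZP N).2.
rewrite (_ : a * e = 2 * (1 + c)); last by rewrite /a divfK// gt_eqF.
lra.
Qed.

End dual_sublevels.

(** * Order continuity from order continuous subgradients *)

Section order_continuous_subgradients.
Context {d : measure_display} {T : measurableType d} {R : realType}.
Context {P : probability T R}.
Variable Phi : Linfty P -> R.
Hypothesis Phi_mon : Defs.monotone Phi.
Hypothesis Phi_cvx : convex_fun Phi.
Implicit Types (U Y : Linfty P).

Local Notation integrable f := (P.-integrable [set: T] (EFin \o f)).
Local Notation "\E f" := (Rintegral P setT f) (at level 10, f at level 8).
Local Notation h m := ((2^-1 : R) ^+ m).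

Let LinftyD Y Y' w : (Y + Y') w = Y w + Y' w. Proof. by []. Qed.
Let LinftyZ (k : R) Y w : (k *: Y) w = k * Y w. Proof. by []. Qed.
Let Linfty0 w : (0 : Linfty P) w = 0. Proof. by []. Qed.

Section decreasing_sequence.
Variables (V : nat -> Linfty P) (K : R).
Hypothesis V_dec : forall n w, 0 <= V n.+1 w <= V n w.
Hypothesis V_le : forall w, V 0 w <= K.

Let V_ge0 n w : 0 <= V n w.
Proof.
by case: n => [|n]; have /andP[? ?] := V_dec 0 w; [lra|have /andP[] := V_dec n w].
Qed.

Let V_anti m n w : (m <= n)%N -> V n w <= V m w.
Proof.
move=> /subnK <-; elim: (n - m)%N => // k; apply: le_trans.
by rewrite addSn; have /andP[] := V_dec (k + m) w.
Qed.

Let Phi_le U U' : (forall w, U w <= U' w) -> Phi U <= Phi U'.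
Proof. by move=> UU'; apply: Phi_mon; exact: nearW. Qed.

(* As [Phi] is monotone, this is also the limit of Phi (U + s V_n). *)
Let L U (s : R) : R := inf (range (fun n => Phi (U + s *: V n))).

Let LP U s : 0 <= s -> has_inf (range (fun n => Phi (U + s *: V n))).
Proof.
move=> s0; split; first by exists (Phi (U + s *: V 0)), 0%N.
exists (Phi U) => _ [n _ <-]; apply: Phi_le => w.
by rewrite LinftyD LinftyZ lerDl mulr_ge0.
Qed.

Let L_le U s n : 0 <= s -> L U s <= Phi (U + s *: V n).
Proof. by move=> s0; apply: ge_inf; [exact: (LP U s0).2|exists n]. Qed.

Let L_half U t : 0 <= t -> L U t <= (Phi U + L U (t + t)) / 2.
Proof.
move=> t0; suff : 2 * L U t - Phi U <= L U (t + t) by lra.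
apply: lb_le_inf; first exact: (LP U (addr_ge0 t0 t0)).1.
move=> _ [n _ <-].
have := @Phi_cvx U (U + (t + t) *: V n) 2^-1; rewrite (_ : 1 - 2^-1 = 2^-1); last lra.
have -> : 2^-1 *: U + 2^-1 *: (U + (t + t) *: V n) = U + t *: V n.
  apply/LfuneqP => w.
  by rewrite !(LinftyD, LinftyZ); field.
move=> /(_ _)/(le_trans (L_le U n t0)) lt; have {}lt := lt _.
by have := lt ltac:(lra); lra.
Qed.

(* Adding a term of the series does not lower the value reached at its end, as
   V N and V n both dominate V (maxn n N). *)
Let L_shift U s t N : 0 <= s -> 0 <= t -> L U (t + s) <= L (U + t *: V N) s.
Proof.
move=> s0 t0; apply: lb_le_inf; first exact: (LP _ s0).1.
move=> _ [n _ <-]; apply: le_trans (L_le U (maxn n N) (addr_ge0 t0 s0)) _.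
apply: Phi_le => w; rewrite !(LinftyD, LinftyZ) -addrA lerD2l mulrDl.
by apply: lerD; apply: ler_wpM2l => //; apply: V_anti; rewrite ?leq_maxr ?leq_maxl.
Qed.

Let next_index U m (eps t : R) : 0 < eps -> 0 <= t ->
  exists2 N, (m <= N)%N & Phi (U + t *: V N) <= L U t + eps.
Proof.
move=> eps0 t0; have [_ [n _ <-] /ltW nP] := inf_adherent eps0 (LP U t0).
exists (maxn n m); first exact: leq_maxr.
apply: le_trans nP; apply: Phi_le => w.
by rewrite !(LinftyD, LinftyZ) lerD2l ler_wpM2l// V_anti// leq_maxl.
Qed.

Let h_gt0 m : 0 < h m. Proof. by rewrite exprn_gt0. Qed.

Let hS m : h m = h m.+1 + h m.+1. Proof. by rewrite exprS; lra. Qed.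

(* The partial sums of the series. The slope (L (U m) (h m) - Phi (U m)) / h m is
   at least 2 eta for m = 0. By convexity it would not decrease from m to m + 1
   if Phi (U m.+1) were equal to L (U m) (h m.+1); picking V N late enough makes
   the loss of slope at step m at most eta h m.+1, hence at most eta in total. *)
Let slope_series (eta : R) : 0 < eta -> (forall n, Phi 0 + 2 * eta <= Phi (V n)) ->
  exists U : nat -> Linfty P, [/\ U 0%N = 0,
    forall m, exists2 N, (m <= N)%N & U m.+1 = U m + h m.+1 *: V N &
    forall m, L (U m) (h m) <= L (U m.+1) (h m.+1) /\
      h m * eta <= L (U m) (h m) - Phi (U m)].
Proof.
move=> eta0 PhiV.
have eps0 m : 0 < h m * h m * eta by rewrite !mulr_gt0.
have /choice[N NP] (Um : Linfty P * nat) : exists N, (Um.2 <= N)%N /\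
    Phi (Um.1 + h Um.2.+1 *: V N) <= L Um.1 (h Um.2.+1) + h Um.2.+1 * h Um.2.+1 * eta.
  by have [N ? ?] := next_index Um.1 Um.2 (eps0 Um.2.+1) (ltW (h_gt0 Um.2.+1)); exists N.
pose U := fix U m := if m is k.+1 then U k + h k.+1 *: V (N (U k, k)) else 0.
have US m : U m.+1 = U m + h m.+1 *: V (N (U m, m)) by [].
have L_nd m : L (U m) (h m) <= L (U m.+1) (h m.+1).
  by rewrite US hS; apply: L_shift; exact: ltW.
have inv m : h m * (eta + eta * h m) <= L (U m) (h m) - Phi (U m).
  elim: m => [|m IH].
    rewrite expr0 mul1r mulr1 lerBrDl; apply: lb_le_inf; first exact: (LP _ ler01).1.
    by move=> _ [n _ <-]; rewrite scale1r add0r -mulr2n -mulr_natl.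
  have t0 := ltW (h_gt0 m.+1).
  have := (NP (U m, m)).2; rewrite /= -US.
  have := L_half (U m) t0; have := L_nd m; move: IH.
  rewrite !(hS m); nra.
exists U; split => // m; first by exists (N (U m, m)); [exact: (NP (U m, m)).1|].
split=> //; apply: le_trans (inv m); rewrite ler_wpM2l ?(ltW (h_gt0 m))//.
by rewrite lerDl mulr_ge0// ltW.
Qed.

Let series_le (U : nat -> Linfty P) m k w : U 0%N = 0 ->
  (forall m, exists2 N, (m <= N)%N & U m.+1 = U m + h m.+1 *: V N) ->
  (m <= k)%N -> U m w <= U k w <= U m w + (h m - h k) * V m w.
Proof.
move=> U0 US /subnK <-; elim: (k - m)%N => [|i /andP[IH1 IH2]].
  by rewrite add0n subrr mul0r addr0 lexx.
rewrite addSn; have [N mN ->] := US (i + m)%N.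
have VN : V N w <= V m w by apply: V_anti; rewrite (leq_trans _ mN)// leq_addl.
have := h_gt0 (i + m).+1; have := V_ge0 N w.
rewrite (hS (i + m)) in IH2; rewrite LinftyD LinftyZ; move: IH1 IH2.
move: (h _) (h _) => a b IH1 IH2 VN0 a0.
by apply/andP; split; nra.
Qed.

(** A finite monotone convex function with an order continuous subgradient at
    every point is order continuous from above at 0. If not, let Y be the sum of
    the series above: since the remainders Y - U m are at most h m V_m, a
    subgradient Z at Y satisfies E[V_m Z] >= eta for all m, which contradicts
    dominated convergence. *)
Lemma order_continuous_subgradients_cvg :
  (forall w, V n w @[n --> \oo] --> (0 : R)) ->
  (forall Y, exists Z : T -> R, [/\ integrable Z, \forall w \ae P, 0 <= Z w &
    forall Y', Phi Y + \E (fun w => (Y' w - Y w) * Z w) <= Phi Y']) ->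
  forall e : R, 0 < e -> exists n, Phi (V n) <= Phi 0 + e.
Proof.
move=> V0 subgrad e e0; apply: contrapT => noV.
pose eta := e / 2; have eta0 : 0 < eta by rewrite divr_gt0.
have [n|U [U0 US LU]] := slope_series eta0.
  by apply/ltW; rewrite ltNge; apply/negP => Vn; apply: noV; exists n; rewrite /eta in Vn; lra.
have U_in m k w : (m <= k)%N -> U m w <= U k w <= U m w + (h m - h k) * V m w.
  exact: series_le.
have U_nd w : nondecreasing_seq (fun k => U k w).
  by move=> m k mk; have /andP[] := U_in m k w mk.
have U_V m k w : (m <= k)%N -> U k w <= U m w + h m * V m w.
  move=> mk; have /andP[_] := U_in m k w mk; have := V_ge0 m w; have := h_gt0 k; nra.
have Uge0 k w : 0 <= U k w by have := U_nd w _ _ (leq0n k); rewrite U0 Linfty0.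
have U_V0 k w : U k w <= V 0 w.
  by have := U_V 0%N k w (leq0n k); rewrite U0 Linfty0 add0r expr0 mul1r.
have Ucvg w : cvgn (fun k => U k w).
  apply: nondecreasing_is_cvgn; first exact: U_nd.
  by exists (V 0 w) => _ [k _ <-].
pose u w := limn (fun k => U k w).
have uP w : U k w @[k --> \oo] --> u w by exact: Ucvg.
have mu : measurable_fun [set: T] u.
  apply: (@measurable_fun_cvg _ _ _ _ (fun k => U k)) => [k|w _].
    exact: measurable_Linfty.
  exact: uP.
have Uu k w : U k w <= u w.
  by apply: nondecreasing_cvgn_le; [exact: U_nd|exact: Ucvg].
have uUV m w : u w <= U m w + h m * V m w.
  by apply: limr_le; [exact: Ucvg|exists m => // k /= mk; exact: U_V].
have [|_ [Y YE]] := @ae_bounded_Linfty _ _ _ P u K mu.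
  apply: nearW => w; rewrite ger0_norm; last exact: le_trans (Uge0 0%N w) (Uu _ _).
  apply: le_trans (V_le w); have := uUV 0%N w.
  by rewrite U0 Linfty0 add0r expr0 mul1r.
have L_nd m k : (m <= k)%N -> L (U m) (h m) <= L (U k) (h k).
  move=> /subnK <-; elim: (k - m)%N => // i; move/le_trans; apply.
  by rewrite addSn; exact: (LU _).1.
pose C := Phi (V 0 + V 0) - Phi 0.
have L_small k : L (U k) (h k) <= Phi (U k) + h k * C.
  apply: le_trans (L_le (U k) 0 (ltW (h_gt0 k))) _.
  have := @Phi_cvx (U k + V 0) (U k) (h k).
  have -> : h k *: (U k + V 0) + (1 - h k) *: U k = U k + h k *: V 0.
    by apply/LfuneqP => w; rewrite !(LinftyD, LinftyZ); ring.
  have h1 : h k <= 1 by rewrite exprn_ile1// invf_le1// ler1n.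
  rewrite (ltW (h_gt0 k)) h1 => /(_ isT).
  have : Phi (U k + V 0) <= Phi (V 0 + V 0).
    by apply: Phi_le => w; rewrite !LinftyD lerD2r.
  have : Phi 0 <= Phi (U k) by apply: Phi_le => w.
  by have := h_gt0 k; rewrite /C; nra.
have C0 : 0 <= C.
  by rewrite subr_ge0; apply: Phi_le => w; rewrite LinftyD Linfty0 addr_ge0.
have LY m : L (U m) (h m) <= Phi Y.
  apply/ler_addgt0Pr => r r0.
  have rC : 0 < r / (C + 1) by rewrite divr_gt0//; lra.
  have [k kr] := halves_lt rC.
  pose n := maxn m k.
  apply: le_trans (L_nd m n (leq_maxl _ _)) _; apply: le_trans (L_small n) _.
  apply: lerD; first by apply: Phi_le => w; rewrite YE.
  have hn : h n <= h k by rewrite ler_wiXn2l ?leq_maxr// invf_le1// ler1n.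
  have : h n * (C + 1) <= r.
    by rewrite -ler_pdivlMr; [exact: le_trans hn (ltW kr)|lra].
  by have := h_gt0 n; lra.
have [Z [Zi Z0 Zsub]] := subgrad Y.
have VZ m : eta <= \E (fun w => V m w * Z w).
  have VZi := integrable_Linfty_mul (V m) Zi.
  have YUi : integrable (fun w => (U m w - Y w) * Z w).
    have := integrable_Linfty_mul (U m - Y) Zi; congr (_.-integrable _ _).
  have hV : - \E (fun w => (U m w - Y w) * Z w) <= h m * \E (fun w => V m w * Z w).
    rewrite -mulN1r -!expectZ//; apply: ae_le_expect.
    - exact: integrableZr_fun.
    - exact: integrableZr_fun.
    - apply: filterS Z0 => w Zw; rewrite mulrA mulrA; apply: ler_wpM2r => //.
      by rewrite mulN1r opprB YE lerBlDl.
  rewrite -(ler_pM2l (h_gt0 m)).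
  have := Zsub (U m); have := LY m; have [_] := LU m; lra.
have [|||||_ _] := @expect_dominated_cvg _ _ _ P (fun m w => V m w * Z w)
    (fun=> 0) (fun w => K * `|Z w|).
- move=> m; apply: measurable_funM; first exact: measurable_Linfty.
  exact: integrable_measurable Zi.
- exact: measurable_cst.
- by apply: nearW => w; rewrite -(mul0r (Z w)); apply: cvgMl; exact: V0.
- by apply: integrableZr_fun; exact: integrable_normr.
- apply: nearW => w m; rewrite normrM ler_wpM2r// ger0_norm//.
  by apply: le_trans (V_le w); exact: V_anti.
rewrite expect_cst => VZ0.
have : eta <= 0 by apply: (ler_cvg_to (cvg_cst eta) VZ0); exact: nearW.
by rewrite leNgt eta0.
Qed.

End decreasing_sequence.
End order_continuous_subgradients.

(** * The dual problem for random variables dominated by [X] *)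

Section dual_problem.
Context {d : measure_display} {T : measurableType d} {R : realType}.
Context {P : probability T R}.
Variable phi : Linfty P -> R.
Hypothesis phi_mc : monotone_convex phi.
Hypothesis phi_Leb : Lebesgue_property phi.
Hypothesis phi0 : phi 0 = 0.
Variable X : {RV P >-> R}.
Hypothesis MX : M_hat phi X.
Implicit Types (V : T -> R) (Y : Linfty P) (Z : L1 P).

Local Notation integrable f := (P.-integrable [set: T] (EFin \o f)).
Local Notation "\E f" := (Rintegral P setT f) (at level 10, f at level 8).
Local Notation h m := ((2^-1 : R) ^+ m).

Let mX : measurable_fun [set: T] X. Proof. exact: measurable_funPT. Qed.
Let mZ Z : measurable_fun [set: T] Z.
Proof. exact: integrable_measurable (L1_integrable Z). Qed.

(** The bound by a multiple of 1 + |X| makes [V Z] integrable for all [Z] in the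
    domain of the conjugate, and the objective coercive in [Z]. *)
Definition dominated V := measurable_fun [set: T] V /\
  exists2 K : R, 0 <= K & \forall w \ae P, `|V w| <= K * (1 + `|X w|).

Definition objective V Z := \E (fun w => V w * Z w) - conjr phi Z.

Let Z_ae_ge0 Z : dom_conj phi Z -> \forall w \ae P, 0 <= Z w.
Proof. exact: dom_conj_ae_ge0 phi_mc.1 phi0 Z. Qed.

Let integrable_normX_mul Z : dom_conj phi Z -> integrable (fun w => `|X w| * Z w).
Proof.
move=> Zd; have mXZ : measurable_fun [set: T] (fun w => `|X w| * Z w).
  by apply: measurable_funM => //; exact: measurableT_comp.
apply/integrableP; split; first exact/measurable_EFinP.
have -> : (\int[P]_w `|(EFin \o (fun w => `|X w| * Z w)%R) w| =
    \int[P]_w (((fun w => 1 * `|X w|) \* Z)%R w)%:E)%E.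
  apply: ae_eq_integral => //.
  - by apply: measurableT_comp => //; exact/measurable_EFinP.
  - apply/measurable_EFinP; apply: measurable_funM => //.
    by apply: measurable_funM => //; exact: measurableT_comp.
  - apply: filterS (Z_ae_ge0 Zd) => w Zw _ /=.
    by rewrite mul1r ger0_norm// mulr_ge0.
have := MX ltr01; rewrite /hat_phi => hX.
have : (dual_objective phi (fun w => 1 * `|X w|)%R Z < +oo)%E.
  by apply: le_lt_trans hX; apply: ereal_sup_ubound; exists Z.
rewrite /dual_objective unlock (dom_conjE phi0 Zd).
by move: (\int[P]_w _)%E => -[r| |]; rewrite ?ltry ?ltNyr.
Qed.

Lemma dominated_integrable V Z : dominated V -> dom_conj phi Z ->
  integrable (fun w => V w * Z w).
Proof.
move=> [mV [K K0 VK]] Zd.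
apply: (ae_le_integrable (g := fun w => K * (`|Z w| + `|X w| * Z w))).
- exact: measurable_funM.
- apply: integrableZr_fun; apply: integrableDr; last exact: integrable_normX_mul.
  by apply: integrable_normr; exact: L1_integrable.
- apply: filterS2 VK (Z_ae_ge0 Zd) => w Vw Zw.
  rewrite normrM (ger0_norm Zw); have := ler_wpM2r Zw Vw.
  by rewrite -mulrA mulrDl mul1r.
Qed.

Lemma dual_objectiveE V Z : dominated V -> dom_conj phi Z ->
  dual_objective phi V Z = (objective V Z)%:E.
Proof.
move=> Vd Zd; rewrite /dual_objective (dom_conjE phi0 Zd) EFinB.
by rewrite -integrable_expect//; exact: dominated_integrable.
Qed.

Lemma hat_phi_ge V Z : dominated V -> dom_conj phi Z ->
  ((objective V Z)%:E <= hat_phi phi V)%E.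
Proof.
by move=> Vd Zd; rewrite -dual_objectiveE//; apply: ereal_sup_ubound; exists Z.
Qed.

Lemma dominated_normX (a : R) : dominated (fun w => a * `|X w|).
Proof.
split; first by apply: measurable_funM => //; exact: measurableT_comp.
exists `|a| => //; apply: nearW => w; rewrite normrM normr_id ler_wpM2l//.
by rewrite lerDr.
Qed.

Lemma dominated_X : dominated X.
Proof.
by split=> //; exists 1 => //; apply: nearW => w; rewrite mul1r lerDr.
Qed.

Lemma dominated_le V V' : measurable_fun [set: T] V -> dominated V' ->
  (forall w, `|V w| <= `|V' w|) -> dominated V.
Proof.
move=> mV [_ [K K0 V'K]] VV'; split=> //; exists K => //.
by apply: filterS V'K => w; apply: le_trans.
Qed.

(** Coercivity: since hat phi(a |X|) is finite for all a, the Fenchel-Young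
    inequality applied to a large multiple of 1 + |X| bounds E[V Z] by a fraction
    of the conjugate. *)
Lemma dominated_objective_le V : dominated V -> exists M : R, forall Z,
  dom_conj phi Z -> \E (fun w => V w * Z w) <= M + conjr phi Z / 2.
Proof.
move=> Vd; have [mV [K K0 VK]] := Vd.
(* The inequalities for a and a |X| add up to a E[(1 + |X|) Z] <= H + phi a +
   2 conjr Z; dividing by 4 leaves half of the conjugate. *)
pose a := 4 * (K + 1).
have a0 : 0 < a by rewrite mulr_gt0//; lra.
have [H HP] : exists H : R, forall Z, dom_conj phi Z ->
    a * \E (fun w => `|X w| * Z w) <= H + conjr phi Z.
  have := MX a0; case E : (hat_phi phi _) => [r|//|] _.
    exists r => Z Zd; have := hat_phi_ge (dominated_normX a) Zd.
    rewrite E lee_fin /objective lerBlDr; apply: le_trans.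
    rewrite -expectZ; last exact: integrable_normX_mul.
    by under eq_Rintegral do rewrite mulrA.
  by exists 0 => Z Zd; have := hat_phi_ge (dominated_normX a) Zd; rewrite E.
have [one oneE] := @cst_Linfty _ _ _ P a.
exists ((H + phi one) / 4) => Z Zd.
have Zi := L1_integrable Z; have XZi := integrable_normX_mul Zd.
have oneZ := fenchel_young phi0 one Zd.
have E1 : \E (fun w => one w * Z w) = a * \E Z.
  by rewrite -expectZ//; apply: eq_Rintegral => w _; rewrite oneE.
have VZ : \E (fun w => V w * Z w) <=
    (K + 1) * (\E Z + \E (fun w => `|X w| * Z w)).
  rewrite -expectD// -expectZ//; last exact: integrableDr.
  apply: ae_le_expect.
  - exact: dominated_integrable.
  - by apply: integrableZr_fun; exact: integrableDr.
  - apply: filterS2 VK (Z_ae_ge0 Zd) => w Vw Zw.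
    have -> : (K + 1) * (Z w + `|X w| * Z w) = (K + 1) * (1 + `|X w|) * Z w by ring.
    apply: ler_wpM2r => //; apply: le_trans (ler_norm _) _; apply: le_trans Vw _.
    by apply: ler_wpM2r; [rewrite addr_ge0|lra].
have := HP _ Zd; move: oneZ VZ; rewrite E1 /a; lra.
Qed.

Let X_UI := forall c : R, 0 < c -> uniformly_integrable P
  [set (X \* Z)%R | Z in [set Z : L1 P | (conj_phi phi Z <= c%:E)%E]].

(** The direct method. A maximising sequence stays in a sublevel set of
    [conj_phi], on which (1 + |X|) Z is uniformly integrable, and the
    superlevel sets of the objective are convex, so that compactness applies to
    the weighted densities (1 + |X|) Z; the objective is upper semicontinuous
    for the resulting convergence. *)
Lemma objective_attained V : X_UI -> dominated V ->
  exists2 Z, dom_conj phi Z & forall Z', dom_conj phi Z' -> objective V Z' <= objective V Z.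
Proof.
move=> C2 Vd; have [mV [K K0 VK]] := Vd.
have [M MP] := dominated_objective_le Vd.
have [Zz Zz0] := exists_dual_zero phi_mc phi_Leb phi0.
have Zzd : dom_conj phi Zz := conj_le_dom Zz0.
pose A : set R := [set objective V Z | Z in dom_conj phi].
have A_sup : has_sup A.
  split; first by exists (objective V Zz), Zz.
  exists M => _ [Z Zd <-]; rewrite /objective; have := MP Z Zd.
  by have := conjr_ge0 phi0 Z; lra.
pose S := sup A.
have AS Z : dom_conj phi Z -> objective V Z <= S.
  by move=> Zd; apply: ub_le_sup; [exact: A_sup.2|exists Z].
pose G w : R := 1 + `|X w|.
have G1 w : 1 <= G w by rewrite lerDl.
have mG : measurable_fun [set: T] G.
  by apply: measurable_funD => //; exact: measurableT_comp.
have GZi Z : dom_conj phi Z -> integrable (fun w => G w * Z w).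
  move=> Zd; apply: dominated_integrable => //; split=> //; exists 1 => //.
  by apply: nearW => w; rewrite mul1r ger0_norm// (le_trans _ (G1 w)).
pose C n : set (T -> R) := [set f | exists Z, [/\ dom_conj phi Z,
  S - h n <= objective V Z & f = (fun w => G w * Z w)]].
have Cne n : C n !=set0.
  have h0 : 0 < h n by rewrite exprn_gt0.
  have [_ [Z Zd <-] /ltW SZ] := sup_adherent h0 A_sup.
  by exists (fun w => G w * Z w), Z.
have Cdec n : C n.+1 `<=` C n.
  move=> f [Z [Zd SZ fE]]; exists Z; split => //; apply: le_trans SZ.
  by rewrite lerD2l lerN2 ler_wiXn2l// invf_le1// ler1n.
have Cmid n f g : C n f -> C n g -> C n (fun w => (f w + g w) / 2).
  move=> [Z1 [Z1d S1 ->]] [Z2 [Z2d S2 ->]].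
  pose Z : L1 P := 2^-1 *: (Z1 + Z2).
  have ZE w : Z w = (Z1 w + Z2 w) / 2 by rewrite mulrC.
  have Zc : (conj_phi phi Z <= ((conjr phi Z1 + conjr phi Z2) / 2)%:E)%E.
    by apply: (conj_midpoint _ _ ZE); rewrite -dom_conjE.
  have Zd := conj_le_dom Zc.
  move: Zc; rewrite (dom_conjE phi0 Zd) lee_fin => Zc.
  exists Z; split=> //; last by apply/funext => w; rewrite ZE; field.
  have VZ : \E (fun w => V w * Z w) =
      2^-1 * (\E (fun w => V w * Z1 w) + \E (fun w => V w * Z2 w)).
    have i1 := dominated_integrable Vd Z1d; have i2 := dominated_integrable Vd Z2d.
    rewrite -expectD// -expectZ//; last exact: integrableDr.
    by apply: eq_Rintegral => w _; rewrite ZE; field.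
  by move: S1 S2; rewrite /objective VZ; lra.
have C0 f : C 0%N f -> \forall w \ae P, 0 <= f w.
  move=> [Z [Zd _ ->]]; apply: filterS (Z_ae_ge0 Zd) => w Zw.
  by rewrite mulr_ge0// (le_trans _ (G1 w)).
pose c := Num.max 1 (2 * (M - S + 1)).
have c0 : 0 < c by rewrite lt_max ltr01.
have CUI : uniformly_integrable P (C 0%N).
  apply: (uniformly_integrable_le_sum
    (sublevel_uniformly_integrable phi_mc phi_Leb phi0 (ltW c0)) (C2 c c0)).
  move=> f [Z [Zd SZ ->]]; split; first exact: measurable_funM.
  have Zc : (conj_phi phi Z <= c%:E)%E.
    rewrite (dom_conjE phi0 Zd) lee_fin le_max; apply/orP; right.
    by have := MP Z Zd; move: SZ; rewrite /objective expr0; lra.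
  exists Z, (X \* Z)%R; split; [by exists Z|by exists Z|move=> w /=].
  rewrite !normrM (ger0_norm (le_trans ler01 (G1 w))) /G mulrDl mul1r//.
have [f_ [f [fC fi ff]]] := midpoint_convex_compact Cne Cdec Cmid C0 CUI.
have /choice[Z_ ZP] n : exists Z, [/\ dom_conj phi Z,
    S - h n <= objective V Z & f_ n = (fun w => G w * Z w)] by exact: fC.
have G0 w : 0 < G w by apply: lt_le_trans (G1 w).
have Zli : integrable (fun w => (G w)^-1 * f w).
  apply: (ae_le_integrable _ (integrable_normr fi)).
    apply: measurable_funM; last exact: integrable_measurable fi.
    apply: (@measurableT_comp _ _ _ _ _ _ (fun x : R => (1 + `|x|)^-1)) => //.
    apply: continuous_measurable_fun => x.
    apply: cvgV; first by rewrite gt_eqF// ltr_pwDl.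
    by apply: cvgD; [exact: cvg_cst|exact: cvg_norm].
  apply: nearW => w; rewrite normrM -[leRHS]mul1r; apply: ler_wpM2r => //.
  by rewrite gtr0_norm ?invr_gt0// invf_le1.
have [Z ZE] := integrable_L1 Zli.
have limE U : dominated U -> \E (fun w => U w * Z_ n w) @[n --> \oo] --> \E (fun w => U w * Z w).
  move=> Ud; have [mU [k k0 Uk]] := Ud.
  have UZ_i n : integrable (fun w => U w * Z_ n w).
    by apply: dominated_integrable => //; have [] := ZP n.
  have UZi : integrable (fun w => U w * Z w).
    apply: (ae_le_integrable (g := fun w => k * `|f w|)).
    - exact: measurable_funM.
    - by apply: integrableZr_fun; exact: integrable_normr.
    - apply: filterS Uk => w Uw; rewrite normrM ZE normrM.
      rewrite (@gtr0_norm _ (G w)^-1) ?invr_gt0//.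
      rewrite mulrA; apply: ler_wpM2r => //.
      by rewrite ler_pdivrMr.
  have fi_ n : integrable (fun w => `|f_ n w - f w|).
    apply: integrable_normr; apply: integrableBr => //.
    by have [Znd _ ->] := ZP n; exact: GZi.
  apply/cvgrPdist_le => e e0.
  have ek : 0 < e / (k + 1) by rewrite divr_gt0//; lra.
  move/cvgr0Pnorm_le : ff => /(_ _ ek); apply: filterS => n.
  rewrite ger0_norm; last exact: Rintegral_ge0.
  rewrite ler_pdivlMr; last lra.
  apply: le_trans; rewrite -expectB//.
  apply: le_trans (le_norm_expect _) _; first exact: integrableBr.
  rewrite mulrC -expectZ//; apply: ae_le_expect.
  - by apply: integrable_normr; exact: integrableBr.
  - exact: integrableZr_fun.
  - apply: filterS Uk => w Uw; have [_ _ ->] := ZP n.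
    rewrite -mulrBr normrM distrC (_ : G w * Z_ n w - f w = G w * (Z_ n w - Z w)).
      rewrite normrM (gtr0_norm (G0 w)) mulrA; apply: ler_wpM2r => //.
      by apply: le_trans Uw _; apply: ler_wpM2r; [exact: ltW|rewrite lerDl].
    by rewrite ZE mulrBr mulrA divff ?mul1r// gt_eqF.
(* Lower semicontinuity of the conjugate: the inequality passes to the limit for
   each bounded Y separately. *)
have Zconj : (conj_phi phi Z <= (\E (fun w => V w * Z w) - S)%:E)%E.
  apply/conj_leP => Y.
  have Yd : dominated Y.
    split; first exact: measurable_Linfty.
    have [k k0 Yk] := Linfty_ae_bounded Y; exists k => //.
    by apply: filterS Yk => w Yw; rewrite (le_trans Yw)// ler_peMr// lerDl.
  have rlim : phi Y + (\E (fun w => V w * Z_ n w) - S + h n) @[n --> \oo] -->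
      phi Y + (\E (fun w => V w * Z w) - S + 0).
    apply: cvgD; first exact: cvg_cst.
    apply: cvgD; first by apply: cvgB; [exact: limE|exact: cvg_cst].
    have h1 : `|2^-1 : R| < 1 by rewrite ger0_norm// invf_lt1// ltr1n.
    have := @cvg_geometric R 1 2^-1 h1.
    by rewrite (_ : geometric 1 2^-1 = (fun n => h n))//; apply/funext => n; rewrite /= mul1r.
  rewrite addr0 in rlim; apply: (ler_cvg_to (limE _ Yd) rlim); apply: nearW => n.
  have [Znd SZn _] := ZP n; have := fenchel_young phi0 Y Znd.
  by move: SZn; rewrite /objective; lra.
have Zd := conj_le_dom Zconj; exists Z => // Z' /AS /le_trans; apply.
by move: Zconj; rewrite (dom_conjE phi0 Zd) lee_fin /objective; lra.
Qed.

Lemma hat_phi_attained V : X_UI -> dominated V ->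
  sup_attained (dom_conj phi) (dual_objective phi V).
Proof.
move=> C2 Vd; have [Z Zd ZP] := objective_attained C2 Vd; exists Z => //.
apply/eqP; rewrite eq_le; apply/andP; split; first by apply: ereal_sup_ubound; exists Z.
apply: ge_ereal_sup => _ [Z' Z'd <-].
by rewrite !dual_objectiveE// lee_fin; exact: ZP.
Qed.


Let tailX (a : R) N w : R := a * `|X w| * \1_[set w' | N%:R < `|X w'|] w.

Let tailX_dominated a N : dominated (tailX a N).
Proof.
apply: (dominated_le _ (dominated_normX a)).
  apply: measurable_funM; first exact: (dominated_normX a).1.
  by apply: measurable_indic; exact: measurable_norm_gt.
move=> w; rewrite /tailX indicE; case: (w \in _); rewrite ?mulr1// mulr0.
by rewrite normr0.
Qed.

(** Split [XZ] at [|X| > N] and [Z > L]: on the first set the Fenchel-Young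
    inequality applies, and elsewhere [|X Z| > N L] forces [Z > L]. *)
Lemma Mu_hat_uniformly_integrable : Mu_hat phi X -> X_UI.
Proof.
move=> C1 c c0; apply/uniformly_integrableP; split.
  move=> _ [Z Zc <-]; exact: dominated_integrable dominated_X (conj_le_dom Zc).
move=> e e0; pose a := 2 * (1 + c) / e.
have a0 : 0 < a by rewrite divr_gt0//; lra.
have [N NP] : exists N, (hat_phi phi (tailX a N) <= 1)%E.
  have /fine_cvgP[[n _ nP]] := C1 a a0.
  move=> /cvgrPdist_lt/(_ 1 ltr01)[m _ mP]; exists (maxn n m).
  have := nP _ (leq_maxl n m); have := mP _ (leq_maxr n m).
  rewrite /= sub0r normrN => /ltr_normlW h1 h2.
  by rewrite -/(tailX a (maxn n m)) -(fineK h2) lee_fin ltW.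
have N1 : 0 < N%:R + 1 :> R by rewrite ltr_wpDl.
have e1 : 0 < e / (2 * (N%:R + 1)) by rewrite divr_gt0// mulr_gt0.
have /uniformly_integrableP[_ /(_ _ e1)[L0 L0P]] :=
  sublevel_uniformly_integrable phi_mc phi_Leb phi0 (ltW c0).
pose L := Num.max 0 L0; have L_ge0 : 0 <= L by rewrite le_max lexx.
exists (N%:R * L) => _ [Z Zc <-].
have Zd := conj_le_dom Zc; have Zi := L1_integrable Z.
have tXi := dominated_integrable (tailX_dominated a N) Zd.
have tXE : \E (fun w => tailX a N w * Z w) <= 1 + c.
  have /le_trans/(_ NP) := hat_phi_ge (tailX_dominated a N) Zd.
  have := Zc; rewrite /= (dom_conjE phi0 Zd) !lee_fin /objective; lra.
have tZi := tail_integrable L Zi.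
have tZE : \E (tail L Z) <= e / (2 * (N%:R + 1)).
  apply: le_trans (L0P Z _); last by exists Z.
  apply: le_expect => [||w]; [exact: tZi|exact: tail_integrable|].
  by rewrite tail_le// le_max lexx orbT.
have XZi := dominated_integrable dominated_X Zd.
have sumi : integrable (fun w => a^-1 * (tailX a N w * Z w) + N%:R * tail L Z w).
  by apply: integrableDr; exact: integrableZr_fun.
apply: (@le_trans _ _ (\E (fun w => a^-1 * (tailX a N w * Z w) + N%:R * tail L Z w))).
  apply: ae_le_expect => //; first exact: tail_integrable.
  apply: filterS (Z_ae_ge0 Zd) => w Zw.
  rewrite /tail /tailX /= normrM (ger0_norm Zw) indicE.
  have N0 : 0 <= N%:R :> R by [].
  have X0 := normr_ge0 (X w).
  have -> (b : R) : a^-1 * (a * `|X w| * b * Z w) = `|X w| * b * Z w.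
    by field; rewrite gt_eqF.
  case: (ltP N%:R `|X w|) => NX.
    rewrite mem_set// mulr1; case: ifP => _; case: ifP => _; rewrite ?addr0 ?mulr0 ?addr0//.
    - by rewrite lerDl mulr_ge0.
    - by rewrite addr_ge0// mulr_ge0.
    - by rewrite mulr_ge0.
  rewrite memNset ?mulr0 ?mul0r ?add0r; last by move=> /=; rewrite ltNge NX.
  case: (ltP (N%:R * L) (`|X w| * Z w)) => XZ; case: (ltP L (Z w)) => LZ.
  - exact: ler_wpM2r.
  - by move: XZ; rewrite ltNge ler_pM.
  - exact: mulr_ge0.
  - by rewrite mulr0.
rewrite expectD; [|exact: integrableZr_fun|exact: integrableZr_fun].
rewrite !expectZ//.
have h1 : a^-1 * \E (fun w => tailX a N w * Z w) <= e / 2.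
  rewrite ler_pdivrMl// (_ : a * (e / 2) = 1 + c)// /a.
  by field; rewrite gt_eqF.
have h2 : N%:R * \E (tail L Z) <= e / 2.
  apply: (@le_trans _ _ ((N%:R + 1) * (e / (2 * (N%:R + 1))))).
    apply: ler_pM => //; last by rewrite lerDl.
    by apply: Rintegral_ge0 => w _; exact: tail_ge0.
  by rewrite le_eqVlt; apply/orP; left; apply/eqP; field; rewrite gt_eqF.
lra.
Qed.

Section weighted_functional.
Variable e : R.
Hypothesis e0 : 0 < e.
Hypothesis attained : forall Y, sup_attained (dom_conj phi)
  (dual_objective phi (fun w => Num.max `|X w| e * Y w)%R).

Let W w : R := Num.max `|X w| e.
Let W_ge0 w : 0 <= W w. Proof. by rewrite le_max normr_ge0. Qed.
Let mW : measurable_fun [set: T] W.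
Proof. by apply: measurable_maxr => //; exact: measurableT_comp. Qed.

Lemma dominated_max_mul Y : dominated (fun w => Num.max `|X w| e * Y w).
Proof.
split.
  by apply: measurable_funM => //; exact: measurable_Linfty.
have [k k0 Yk] := Linfty_ae_bounded Y.
exists ((1 + e) * k); first by rewrite mulr_ge0// addr_ge0// ltW.
apply: filterS Yk => w Yw; rewrite normrM (ger0_norm (W_ge0 w)) mulrAC.
apply: ler_pM => //.
have X0 := normr_ge0 (X w).
have eX0 := mulr_ge0 (ltW e0) X0; have := e0.
by rewrite /W ge_max mulrDl mul1r mulrDr mulr1 => ?; apply/andP; split; lra.
Qed.

Let W_dominated Y : dominated (fun w => W w * Y w).
Proof. exact: dominated_max_mul. Qed.

(* Finite, as [attained] makes it a value of the real-valued objective. *)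
Let Phi Y : R := fine (hat_phi phi (fun w => W w * Y w)).

Let hat_PhiP Y : exists Z, [/\ dom_conj phi Z,
  hat_phi phi (fun w => W w * Y w) = (Phi Y)%:E &
  Phi Y = objective (fun w => W w * Y w) Z].
Proof.
have [Z Zd ZE] := attained Y; exists Z.
have hE : hat_phi phi (fun w => W w * Y w) = (objective (fun w => W w * Y w) Z)%:E.
  by rewrite -dual_objectiveE.
by split => //; rewrite /Phi hE.
Qed.

Let Phi_ge Y Z : dom_conj phi Z -> objective (fun w => W w * Y w) Z <= Phi Y.
Proof.
move=> Zd; have [_ [_ hE _]] := hat_PhiP Y.
by rewrite -lee_fin -hE; exact: hat_phi_ge.
Qed.

Let WZi Y Z : dom_conj phi Z -> integrable (fun w => W w * Y w * Z w).
Proof. by move=> Zd; exact: dominated_integrable. Qed.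

Let Phi_mon : Defs.monotone Phi.
Proof.
move=> Y Y' YY'; have [Z [Zd _ ->]] := hat_PhiP Y.
apply: le_trans (Phi_ge Y' Zd); rewrite lerD2r.
apply: ae_le_expect; [exact: WZi|exact: WZi|].
apply: filterS2 YY' (Z_ae_ge0 Zd) => w Yw Zw.
by apply: ler_wpM2r => //; exact: ler_wpM2l.
Qed.

Let Phi_cvx : convex_fun Phi.
Proof.
move=> Y Y' t /andP[t0 t1]; have [Z [Zd _ ->]] := hat_PhiP (t *: Y + (1 - t) *: Y').
have t1' : 0 <= 1 - t by lra.
have := ler_wpM2l t0 (Phi_ge Y Zd); have := ler_wpM2l t1' (Phi_ge Y' Zd).
rewrite /objective.
have -> : \E (fun w => W w * (t *: Y + (1 - t) *: Y') w * Z w) =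
    t * \E (fun w => W w * Y w * Z w) + (1 - t) * \E (fun w => W w * Y' w * Z w).
  rewrite -!expectZ ?WZi// -expectD; [|by apply: integrableZr_fun; exact: WZi..].
  apply: eq_Rintegral => w _.
  by rewrite (_ : (t *: Y + (1 - t) *: Y') w = t * Y w + (1 - t) * Y' w)//; ring.
lra.
Qed.

Let Phi_subgradient Y : exists Z : T -> R, [/\ integrable Z,
  \forall w \ae P, 0 <= Z w &
  forall Y', Phi Y + \E (fun w => (Y' w - Y w) * Z w) <= Phi Y'].
Proof.
have [Z [Zd _ YE]] := hat_PhiP Y; exists (fun w => W w * Z w); split.
- have [one oneE] := @cst_Linfty _ _ _ P 1.
  have := WZi one Zd; congr (_.-integrable _ _); apply/funext => w /=.
  by rewrite oneE mulr1.
- by apply: filterS (Z_ae_ge0 Zd) => w Zw; rewrite mulr_ge0.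
- move=> Y'; apply: le_trans (Phi_ge Y' Zd); rewrite YE /objective.
  have -> : \E (fun w => (Y' w - Y w) * (W w * Z w)) =
      \E (fun w => W w * Y' w * Z w) - \E (fun w => W w * Y w * Z w).
    by rewrite -expectB ?WZi//; apply: eq_Rintegral => w _; ring.
  lra.
Qed.

(** [W] coincides with [|X|] where [|X| > n] as soon as [n >= e], so that
    hat phi(a |X| 1_(|X| > n)) is the value of [Phi] at a 1_(|X| > n), and
    these functions decrease to 0. *)
Lemma attained_Mu_hat : Mu_hat phi X.
Proof.
move=> a a0.
have mA n : measurable [set w | n%:R < `|X w|] by exact: measurable_norm_gt.
pose v n w : R := a * \1_[set w' | n%:R < `|X w'|] w.
have vE n w : v n w = if n%:R < `|X w| then a else 0.
  rewrite /v indicE; case: ifPn => h; first by rewrite mem_set ?mulr1.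
  by rewrite memNset ?mulr0//; exact/negP.
have v01 n w : 0 <= v n w <= a by rewrite vE; case: ifP => _; rewrite ?lexx ?(ltW a0).
have /choice[V VE] n : exists Y, (Y : T -> R) = v n.
  have [||_ //] := @ae_bounded_Linfty _ _ _ P (v n) a.
  - by apply: measurable_funM => //; exact: measurable_indic.
  - by apply: nearW => w; have /andP[? ?] := v01 n w; rewrite ger0_norm.
have V_dec n w : 0 <= V n.+1 w <= V n w.
  rewrite !VE; have /andP[-> _] := v01 n.+1 w; rewrite !vE.
  case: (ltP n.+1%:R `|X w|) => h1; last by case: ifP => //= _; exact: ltW.
  by rewrite (lt_trans _ h1)//= ltr_nat.
have V_le w : V 0%N w <= a by rewrite VE; have /andP[] := v01 0%N w.
have V_cvg w : V n w @[n --> \oo] --> (0 : R).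
  apply: cvg_near_cst; exists (truncn `|X w|).+1 => // n /= nX.
  rewrite VE vE ltNge (le_trans (ltW (truncnS_gt `|X w|)))// ler_nat//.
have PhiV_cvg := order_continuous_subgradients_cvg Phi_mon Phi_cvx V_dec V_le V_cvg
  Phi_subgradient.
have Phi0 : Phi 0 <= 0.
  have [Z [Zd _ ->]] := hat_PhiP 0; rewrite /objective.
  have -> : \E (fun w => W w * (0 : Linfty P) w * Z w) = 0.
    rewrite -[RHS](expect_cst P); apply: eq_Rintegral => w _.
    by rewrite (_ : (0 : Linfty P) w = 0)// mulr0 mul0r.
  by rewrite sub0r oppr_le0 (conjr_ge0 phi0).
have [Zz Zz0] := exists_dual_zero phi_mc phi_Leb phi0.
have Zzd : dom_conj phi Zz := conj_le_dom Zz0.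
have PhiV_ge0 n : 0 <= Phi (V n).
  apply: le_trans (Phi_ge (V n) Zzd); rewrite /objective.
  have -> : conjr phi Zz = 0.
    apply/eqP; rewrite eq_le (conjr_ge0 phi0) andbT.
    by rewrite -lee_fin -dom_conjE.
  rewrite subr0 -(expect_cst P 0); apply: ae_le_expect.
  - exact: integrable_cst_fun.
  - exact: WZi.
  - apply: filterS (Z_ae_ge0 Zzd) => w Zw; rewrite !mulr_ge0// VE.
    by have /andP[] := v01 n w.
have Vanti m n w : (m <= n)%N -> V n w <= V m w.
  move=> /subnK <-; elim: (n - m)%N => // k; apply: le_trans.
  by rewrite addSn; have /andP[] := V_dec (k + m)%N w.
pose N0 := (truncn e).+1.
have hatE n : (N0 <= n)%N -> hat_phi phi (tailX a n) = (Phi (V n))%:E.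
  move=> Nn; have [_ [_ <- _]] := hat_PhiP (V n).
  congr (hat_phi phi _); apply/funext => w.
  rewrite VE /tailX -/(v n w) [a * _]mulrC -mulrA -/(v n w) vE.
  case: ltP => nX; last by rewrite !mulr0.
  rewrite /W max_l//; apply: ltW; apply: lt_trans nX.
  by apply: lt_le_trans (truncnS_gt e) _; rewrite ler_nat.
apply: cvg_EFin.
  exists N0 => // n /= Nn; rewrite -/(tailX a n).
  by have := hatE n Nn; rewrite /tailX => ->.
apply/cvgrPdist_le => r r0.
have [n nP] := PhiV_cvg r r0; exists (maxn n N0) => // m /=.
rewrite geq_max => /andP[nm Nm].
have := hatE m Nm; rewrite /tailX => -> /=; rewrite sub0r normrN ger0_norm//.
apply: (@le_trans _ _ (Phi (V n))); last lra.
by apply: Phi_mon; apply: nearW => w; exact: Vanti.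
Qed.

End weighted_functional.

End dual_problem.

(** * The equivalence *)

Local Open Scope ereal_scope.

Theorem theorem3p8 (d : measure_display) (T : measurableType d)
    (R : realType) (P : probability T R) (phi0 : Linfty P -> R)
    (phi0_mc : monotone_convex phi0) (phi0_Leb : Lebesgue_property phi0)
    (phi00 : phi0 (0%R : Linfty P) = 0%R)
    (X : {RV P >-> R}) (MX : M_hat phi0 X) :
  let C1 := Mu_hat phi0 X in
  let C2 := forall c : R, (0 < c)%R ->
    uniformly_integrable P
      [set (X \* Z)%R | Z in [set Z : L1 P | conj_phi phi0 Z <= c%:E]] in
  let C3 := exists2 e : R, (0 < e)%R & forall Y : Linfty P,
    sup_attained (dom_conj phi0)
      (dual_objective phi0 (fun w => Num.max `|X w| e * Y w)%R) in
  (C1 <-> C2) /\ (C2 <-> C3) /\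
  (C1 -> exists2 Z, dom_conj phi0 Z &
           hat_phi phi0 X = 'E_P[X \* Z] - conj_phi phi0 Z).
Proof.
move=> C1 C2 C3.
have C12 : C1 -> C2 by exact: Mu_hat_uniformly_integrable phi0_mc phi0_Leb phi00 X MX.
have attained V : C2 -> dominated X V ->
    sup_attained (dom_conj phi0) (dual_objective phi0 V).
  exact: hat_phi_attained phi0_mc phi0_Leb phi00 X MX V.
have C23 : C2 -> C3.
  move=> UI; exists 1%R; first exact: ltr01.
  by move=> Y; apply: attained => //; apply: dominated_max_mul; exact: ltr01.
have C31 : C3 -> C1.
  by move=> [e e0 sup]; exact: attained_Mu_hat phi0_mc phi0_Leb phi00 X MX e e0 sup.
split; first by split=> // /C23.
split; first by split=> // /C31.
by move=> /C12 UI; have [Z Zd ZE] := attained X UI (dominated_X X); exists Z.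
Qed.
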